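(* For each integer $q\ge 3$ there is a constant $\Lambda_q$ with $1\le \Lambda_q\le 2$ such that \[ T(n,q,2)=(\Lambda_q+o(1))\left(\frac{q}{2}\right)^n \qquad (n\to\infty), \] where, for fixed $q$, $o(1)$ denotes a quantity tending to $0$ as $n\to\infty$. Furthermore, when $q=3$, we have $\frac{7}{4}\le \Lambda_3\le 2$.
   Context: For integers $q>p\ge 1$ and $n\ge 0$, $T(n,q,p)$ denotes the minimum number of translates of the cube $\{0,1,\dots,p-1\}^n$ required to cover the $n$-dimensional torus $(\mathbb{Z}/q\mathbb{Z})^n$. That is, $T(n,q,p)$ is the minimum size of a set $\mathcal{S}\subseteq(\mathbb{Z}/q\mathbb{Z})^n$ such that $\bigcup_{s\in\mathcal{S}}\bigl(s+\{0,1,\dots,p-1\}^n\bigr)=(\mathbb{Z}/q\mathbb{Z})^n$, with addition taken coordinatewise modulo $q$. *)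

(* Defs.v *)
From mathcomp Require Import all_boot all_order all_algebra.

Set Implicit Arguments.
Unset Strict Implicit.
Unset Printing Implicit Defensive.

Import GRing.Theory.

Local Open Scope ring_scope.

(* The torus (Z/qZ)^n is 'rV['Z_q]_n. 'Z_q is Z/qZ only for 1 < q; for q <= 1 *)
(* it is Z/2Z, so everything below is meaningful only under 1 < q.            *)

Definition cube (n q p : nat) : {set 'rV['Z_q]_n} :=
  [set x : 'rV['Z_q]_n | [forall i, (x ord0 i < p)%N]].

Definition translate (n q : nat) (s : 'rV['Z_q]_n) (A : {set 'rV['Z_q]_n}) :
    {set 'rV['Z_q]_n} :=
  [set s + x | x in A].

Definition covers (n q p : nat) (S : {set 'rV['Z_q]_n}) : bool :=
  \bigcup_(s in S) translate s (cube n q p) == [set: 'rV['Z_q]_n].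

(* The arg min needs a covering set as seed: the whole torus is one as soon   *)
(* as 0 < p.                                                                  *)
Definition T (n q p : nat) : nat :=
  #|[arg min_(S < [set: 'rV['Z_q]_n] | covers p S) #|S|]%N|.

(* Main.v *)
From HB Require Import structures.
From Stdlib Require Import NArith.
Require Import Defs.
From mathcomp Require Import all_boot all_order all_algebra.
From mathcomp Require Import zify ring lra.
Set Implicit Arguments.
Unset Strict Implicit.
Unset Printing Implicit Defensive.

(** Write a_n for T(n,q,2) / (q/2)^n.  Cutting the torus along one coordinate shows that
    q T(n,q,2) <= 2 T(n+1,q,2) ([T_slab]): each of the q slabs has to be covered by the cubes
    that meet it, and a cube meets two slabs.  So a_n is nondecreasing and starts at a_0 = 1.
    It therefore converges to its supremum, and the theorem amounts to a_n <= 2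
    ([T_upper]) and, for q = 3, to a_10 >= 7/4, that is T(10,3,2) >= 101 ([T10_ge]).

    Upper bound.  For q = 3 the set {0, 1} is the complement of a point, so that T(n,3,2) is
    the least number of words over three letters such that every word differs everywhere from
    one of them.  Fix a graph on the n coordinates.  To each vertex set that induces a
    subgraph with all degrees even, attach the word with letter 0 on the set and letters 1 or
    2 outside, according to the parity of the number of neighbours in the set.  The lights out
    lemma (over F_2 the diagonal of a symmetric matrix lies in its row space) shows that these
    words form a cover ([word_of_avoids]).  In a random graph the expected number of such sets
    is 2 (3/2)^n - 1, and a graph that does as well is built greedily ([few_eulerian]).  For
    other q, colour the residues with three colours so that consecutive ones differ, and pull
    the cover of words back; averaging over shifts of the colours keeps the density.

    Lower bound.  Since 2 T(10) >= 3 T(9), it is enough that no 66 words cover in dimension 9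
    ([size_cover_dim9]).  In a cover, the words that do not start with a given letter have
    tails that cover the dimension below, and choosing the most frequent letter leaves at most
    two thirds of the words.  If the tails form a minimum cover P, the tails of the remaining
    words must hit every point that P covers exactly once ([third_hits_once]), and a cover
    with these tails is rebuilt by a finite search ([extensions]).  Hence minimum covers can
    be classified by induction on the dimension.  They have 1, 2, 3, 5, 8, 12, 18 and 29 words in
    dimensions 0 to 7 and are unique up to symmetry; for 29 the nonminimum covers with 19
    words in dimension 6 have to be classified too.  The covers with 44 words in dimension 8
    are, up to symmetry, those of an explicit list.  Finally a cover with 66 words would split into one of these and 22
    words that hit all it covers exactly once, but 22 words do not hit that many points
    ([no_third44]).  The searches are evaluated by the kernel; they become
    small enough because a list of words that hits a given set is again cut by the first
    letter and assembled from the lists found one dimension below ([glue_complete]). *)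

(** * Words over three letters and sets of words as ternary trees *)

Inductive letter := La | Lb | Lc.
Definition eql (a b : letter) : bool :=
  match a, b with La, La | Lb, Lb | Lc, Lc => true | _, _ => false end.
Lemma eqlP : Equality.axiom eql. Proof. by do 2 case; constructor. Qed.
HB.instance Definition _ := hasDecEq.Build letter eqlP.
Definition letters := [:: La; Lb; Lc].
Notation word := (seq letter).

(** After a shift of coordinates this is membership of [x] in the translate of
    {0, 1}^n at [s]: in Z/3Z the set {0, 1} is the complement of a point. *)
Fixpoint hits (s x : word) : bool :=
  match s, x with
  | [::], [::] => true
  | a :: s, b :: x => if eql a b then false else hits s x
  | _, _ => false
  end.

Lemma hitsE s x : size s = size x ->
  hits s x = all (fun i => nth La s i != nth La x i) (iota 0 (size s)).
Proof.
elim: s x => [|a s IH] [|b x] //= [ss]; rewrite -[eql a b]/(a == b).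
by case: (a == b) => //=; rewrite (iotaDl 1 0) all_map IH.
Qed.

(** A tree of depth at most n is a function on the words of length n; a leaf met
    early stands for a constant function on a subcube. *)
Inductive tree (A : Type) := Leaf of A | Node of tree A & tree A & tree A.
Notation full := (Leaf true).

Fixpoint get A (t : tree A) (w : word) : A :=
  match t with
  | Leaf b => b
  | Node a b c =>
    match w with
    | [::] => get a [::]
    | La :: w => get a w | Lb :: w => get b w | Lc :: w => get c w
    end
  end.
Definition child A (l : letter) (t : tree A) : tree A :=
  match t with
  | Leaf _ => t
  | Node a b c => match l with La => a | Lb => b | Lc => c end
  end.
Fixpoint map_tree A B (f : A -> B) t :=
  match t with
  | Leaf b => Leaf (f b)
  | Node a b c => Node (map_tree f a) (map_tree f b) (map_tree f c)
  end.
Fixpoint zip_tree A B C (f : A -> B -> C) t u :=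
  match t, u with
  | Leaf b, _ => map_tree (f b) u
  | _, Leaf d => map_tree (f^~ d) t
  | Node a b c, Node a' b' c' => Node (zip_tree f a a') (zip_tree f b b') (zip_tree f c c')
  end.
Definition node (a b c : tree bool) :=
  match a, b, c with
  | Leaf false, Leaf false, Leaf false => Leaf false
  | _, _, _ => Node a b c
  end.
Arguments node : simpl never.
Fixpoint remove (s : word) (t : tree bool) : tree bool :=
  match s with
  | [::] => Leaf false
  | l :: s =>
    match t with
    | Leaf false => t
    | Leaf true =>
      let d := remove s t in
      match l with La => Node t d d | Lb => Node d t d | Lc => Node d d t end
    | Node a b c =>
      match l with
      | La => node a (remove s b) (remove s c)
      | Lb => node (remove s a) b (remove s c)
      | Lc => node (remove s a) (remove s b) c
      end
    end
  end.
Fixpoint restrict (s : word) (t : tree bool) : tree bool :=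
  match s with
  | [::] => t
  | l :: s =>
    match t with
    | Leaf false => t
    | Leaf true =>
      let d := restrict s t in let e := Leaf false in
      match l with La => Node e d d | Lb => Node d e d | Lc => Node d d e end
    | Node a b c =>
      let e := Leaf false in
      match l with
      | La => node e (restrict s b) (restrict s c)
      | Lb => node (restrict s a) e (restrict s c)
      | Lc => node (restrict s a) (restrict s b) e
      end
    end
  end.
Fixpoint all_false (t : tree bool) :=
  match t with Leaf b => ~~ b | Node a b c => [&& all_false a, all_false b & all_false c] end.
Fixpoint find_word n (t : tree bool) : option word :=
  match n with
  | 0 => if get t [::] then Some [::] else None
  | n.+1 =>
    if all_false t then None else
    match find_word n (child La t) with Some w => Some (La :: w) | None =>
    match find_word n (child Lb t) with Some w => Some (Lb :: w) | None =>
    match find_word n (child Lc t) with Some w => Some (Lc :: w) | None => None end end end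
  end.
Definition empty n t := if find_word n t is Some _ then false else true.

Lemma get_child A (t : tree A) l w : get (child l t) w = get t (l :: w).
Proof. by case: t => //= a b c; case: l. Qed.
Lemma get_map_tree A B (f : A -> B) t w : get (map_tree f t) w = f (get t w).
Proof. by elim: t w => //= a IHa b IHb c IHc [|[] w]. Qed.
Lemma get_zip_tree A B C (f : A -> B -> C) t u w :
  get (zip_tree f t u) w = f (get t w) (get u w).
Proof.
elim: t u w => [b|a IHa b IHb c IHc] u w.
  by rewrite [zip_tree _ _ _]/= get_map_tree.
case: u => [d|a' b' c'].
  by rewrite -[zip_tree _ _ _]/(map_tree (f^~ d) (Node a b c)) get_map_tree.
by case: w => [|[] w] /=.
Qed.
Lemma get_node a b c w : get (node a b c) w = get (Node a b c) w.
Proof.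
case: a => [[]|? ? ?]; case: b => [[]|? ? ?]; case: c => [[]|? ? ?] //=.
by case: w => [|[]].
Qed.
Lemma get_remove s t x : size x = size s -> get (remove s t) x = get t x && ~~ hits s x.
Proof.
elim: s t x => [|l s IH] t [|m x] //=; first by rewrite andbF.
move=> [sx]; case: t => [[]|a b c] //=.
  by case: l; case: m => /=; rewrite ?IH ?andbT.
by case: l => /=; rewrite get_node; case: m => /=; rewrite ?IH ?andbT.
Qed.
Lemma get_restrict s t x : size x = size s -> get (restrict s t) x = get t x && hits s x.
Proof.
elim: s t x => [|l s IH] t [|m x] //=; first by rewrite andbT.
move=> [sx]; case: t => [[]|a b c] //=.
  by case: l; case: m => /=; rewrite ?IH ?andbF.
by case: l => /=; rewrite get_node; case: m => /=; rewrite ?IH ?andbF.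
Qed.
Lemma all_false_get t w : all_false t -> get t w = false.
Proof.
elim: t w => [b|a IHa b IHb c IHc] w /=; first by move/negbTE.
by case/and3P => Ha Hb Hc; case: w => [|[] w]; auto.
Qed.
Lemma find_wordP n t :
  if find_word n t is Some x then size x = n /\ get t x
  else forall x, size x = n -> get t x = false.
Proof.
elim: n t => [|n IH] t /=; first by case: ifP => // tF [].
case: ifP => [/all_false_get tF //|_].
have := IH (child La t); case: find_word => [w [<-]|Ha]; first by rewrite get_child.
have := IH (child Lb t); case: find_word => [w [<-]|Hb]; first by rewrite get_child.
have := IH (child Lc t); case: find_word => [w [<-]|Hc]; first by rewrite get_child.
by case=> // -[] x [sx]; rewrite -get_child ?Ha ?Hb ?Hc.
Qed.
Lemma emptyP n t : reflect (forall x, size x = n -> get t x = false) (empty n t).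
Proof.
rewrite /empty; have := find_wordP n t; case: find_word => [x [sx tx]|H]; constructor => //.
by move=> /(_ x sx); rewrite tx.
Qed.

Fixpoint words n : seq word :=
  if n is n.+1 then
    let r := words n in map (cons La) r ++ map (cons Lb) r ++ map (cons Lc) r
  else [:: [::]].
Definition all_size (n : nat) (X : seq word) := all (fun w => size w == n) X.

Lemma cons_inj (l : letter) : injective (cons l). Proof. by move=> u v []. Qed.
Lemma mem_words n w : (w \in words n) = (size w == n).
Proof.
elim: n w => [|n IH] [|l w] //=; rewrite ?mem_cat.
  by apply/negP => /or3P[] /mapP[].
rewrite eqSS -IH; case: l.
- by rewrite (mem_map (@cons_inj La)) orb_idr // => /orP[] /mapP[].
- rewrite (mem_map (@cons_inj Lb)); case: (w \in words n); rewrite ?orbT //.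
  by apply/negP => /or3P[] // /mapP[].
rewrite (mem_map (@cons_inj Lc)); case: (w \in words n); rewrite ?orbT //.
by apply/negP => /or3P[] // /mapP[].
Qed.
Lemma uniq_words n : uniq (words n).
Proof.
elim: n => [|n IH] //=; rewrite !cat_uniq !(map_inj_uniq (@cons_inj _)) IH /= andbT -!all_predC.
apply/andP; split; apply/allP => u.
  by rewrite mem_cat => /orP[] /mapP[v _ ->]; apply/negP => /mapP[].
by move=> /mapP[v _ ->]; apply/negP => /mapP[].
Qed.

Definition hits_all (n : nat) (t : tree bool) (X : seq word) :=
  forall x, size x = n -> get t x -> has (hits^~ x) X.
Lemma hits_all_perm n t X Y : perm_eq X Y -> hits_all n t X -> hits_all n t Y.
Proof. by move=> XY H x sx tx; rewrite -(perm_has _ XY); apply: H. Qed.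
Lemma hits_all_remove n t s X : size s = n -> hits_all n t (s :: X) -> hits_all n (remove s t) X.
Proof.
move=> ss H x sx; rewrite get_remove ?sx // => /andP[tx /negbTE sxF].
by have := H x sx tx; rewrite /= sxF.
Qed.

(** * Exhaustive search with a counting bound *)

Fixpoint npoints n (t : tree bool) : N :=
  match n with
  | 0 => if get t [::] then 1%num else 0%num
  | n.+1 =>
    match t with
    | Leaf false => 0%num
    | _ => N.add (npoints n (child La t)) (N.add (npoints n (child Lb t)) (npoints n (child Lc t)))
    end
  end.
(** The number of points of [t] hit by each word, for all words at once: a discrete
    transform, one coordinate at a time. *)
Fixpoint weights n (t : tree bool) : tree N :=
  match n with
  | 0 => Leaf (if get t [::] then 1%num else 0%num)
  | n.+1 =>
    match t with
    | Leaf false => Leaf 0%num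
    | _ =>
      let a := weights n (child La t) in
      let b := weights n (child Lb t) in
      let c := weights n (child Lc t) in
      Node (zip_tree N.add b c) (zip_tree N.add a c) (zip_tree N.add a b)
    end
  end.
Fixpoint max_tree (t : tree N) : N :=
  match t with
  | Leaf n => n
  | Node a b c => N.max (max_tree a) (N.max (max_tree b) (max_tree c))
  end.
Fixpoint hitters (x : word) : seq word :=
  if x is l :: x then
    let r := hitters x in
    match l with
    | La => map (cons Lb) r ++ map (cons Lc) r
    | Lb => map (cons La) r ++ map (cons Lc) r
    | Lc => map (cons La) r ++ map (cons Lb) r
    end
  else [:: [::]].
(** Lists of at most [k] words that hit all of [t], found by branching on the word
    that hits one chosen point.  A branch is cut as soon as [k] words of the largest
    weight cannot account for all the points left. *)
Fixpoint solve n k t : seq (seq word) :=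
  if find_word n t is Some x then
    if k is k'.+1 then
      let W := weights n t in
      let m := max_tree W in
      let c := npoints n t in
      if N.ltb (N.mul (N.of_nat k) m) c then [::] else
      let lim := N.mul (N.of_nat k') m in
      flatten [seq (if N.ltb (N.add (get W s) lim) c then [::]
                    else [seq s :: R | R <- solve n k' (remove s t)]) | s <- hitters x]
    else [::]
  else [:: [::]].

Definition num_hit n t s := count (fun x => get t x && hits s x) (words n).

Lemma npointsE n t : N.to_nat (npoints n t) = count (get t) (words n).
Proof.
elim: n t => [|n IH] t /=; first by case: (get t [::]).
rewrite !count_cat !count_map.
have E l : count (preim (cons l) (get t)) (words n) = count (get (child l t)) (words n).
  by apply: eq_count => x /=; rewrite get_child.
rewrite !E; case: t {E} => [[]|a b c]; rewrite ?Nnat.N2Nat.inj_add ?IH //=.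
by elim: (words n).
Qed.
Lemma weightsE n t s : size s = n -> N.to_nat (get (weights n t) s) = num_hit n t s.
Proof.
rewrite /num_hit; elim: n t s => [|n IH] t [|l s] //=; first by case: (get t [::]).
case=> ss; rewrite !count_cat !count_map.
have E m : count (preim (cons m) (fun x => get t x && hits (l :: s) x)) (words n)
    = if l == m then 0 else num_hit n (child m t) s.
  rewrite -[l == m]/(eql l m) /preim /=; case: (eql l m).
    by rewrite (@eq_count _ _ pred0) ?count_pred0 // => x /=; rewrite andbF.
  by apply: eq_count => x /=; rewrite get_child.
have main : N.to_nat (get (Node (zip_tree N.add (weights n (child Lb t)) (weights n (child Lc t)))
     (zip_tree N.add (weights n (child La t)) (weights n (child Lc t)))
     (zip_tree N.add (weights n (child La t)) (weights n (child Lb t)))) (l :: s)) =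
   (if l == La then 0 else num_hit n (child La t) s) +
    ((if l == Lb then 0 else num_hit n (child Lb t) s)
     + (if l == Lc then 0 else num_hit n (child Lc t) s)).
  by case: l {E} => /=; rewrite get_zip_tree Nnat.N2Nat.inj_add !IH //= ?addn0.
rewrite !E; case: t {E} main => [[]|a b c] // _.
have -> m : num_hit n (child m (Leaf false)) s = 0 by rewrite /num_hit; elim: (words n).
by case: l.
Qed.
Lemma max_treeP (t : tree N) w : N.to_nat (get t w) <= N.to_nat (max_tree t).
Proof.
elim: t w => [m|a IHa b IHb c IHc] w //=.
have Ha v := IHa v; have Hb v := IHb v; have Hc v := IHc v.
by case: w => [|[] w]; [have := Ha [::]|have := Ha w|have := Hb w|have := Hc w]; lia.
Qed.
Lemma N_ltbE a b : N.ltb a b = (N.to_nat a < N.to_nat b).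
Proof. by apply/idP/idP => [/N.ltb_lt|H]; [|apply/N.ltb_lt]; lia. Qed.

Lemma count_le_sum_hit n t X : hits_all n t X ->
  count (get t) (words n) <= \sum_(s <- X) num_hit n t s.
Proof.
rewrite /num_hit => tX.
have: {in words n, forall x, get t x -> has (hits^~ x) X}.
  by move=> x; rewrite mem_words => /eqP; apply: tX.
elim: (words n) => [|x L IH] H //=.
rewrite big_split /=; apply: leq_add; last by apply: IH => y yL; apply: H; rewrite inE yL orbT.
case tx: (get t x) => //=.
have /hasP[s sX sx] := H x (mem_head _ _) tx.
by rewrite (big_rem s) //= sx.
Qed.
Lemma sum_le_const (X : seq word) (f : word -> nat) m :
  (forall s, s \in X -> f s <= m) -> \sum_(s <- X) f s <= size X * m.
Proof.
elim: X => [|s X IH] H; first by rewrite big_nil.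
rewrite big_cons mulSn leq_add ?H ?mem_head //.
by apply: IH => u uX; apply: H; rewrite inE uX orbT.
Qed.
Lemma mem_hitters s x : hits s x -> s \in hitters x.
Proof.
elim: x s => [|m x IH] [|l s] //=.
by case: m; case: l => //= /IH H; rewrite mem_cat !(mem_map (@cons_inj _)) ?H ?orbT.
Qed.

(** [X] is only required to contain a member of [L], since a search stops as soon as
    nothing is left to hit, possibly before [k] words are used. *)
Definition complete (n : nat) t k (L : seq (seq word)) :=
  forall X : seq word, all_size n X -> size X <= k -> hits_all n t X ->
  exists R Z : seq word, R \in L /\ perm_eq X (R ++ Z).

Local Arguments N.of_nat : simpl never.
Local Arguments N.mul : simpl never.
Local Arguments N.add : simpl never.
Local Arguments N.ltb : simpl never.
Lemma solve_complete n k t : complete n t k (solve n k t).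
Proof.
elim: k t => [|k IH] t X wX sX tX /=; have := find_wordP n t;
  case: find_word => [x [sx tx]|tF].
- by move: sX (tX x sx tx); case: X {wX tX}.
- by exists [::], X; rewrite mem_head perm_refl.
- rewrite !N_ltbE Nnat.N2Nat.inj_mul Nnat.Nat2N.id npointsE.
  set m := N.to_nat (max_tree _).
  have Wm s : s \in X -> num_hit n t s <= m.
    by move=> sX'; rewrite -weightsE ?max_treeP //; apply/eqP; apply: (allP wX).
  have := count_le_sum_hit tX; have := sum_le_const Wm => H1 H2.
  rewrite ltnNge (_ : (_ <= _) = true) /=; last first.
    apply: leq_trans H2 _; apply: leq_trans H1 _.
    by rewrite -[X in _ <= X]/(k.+1 * m) leq_mul2r sX orbT.
  have /hasP[s sXin sx'] := tX x sx tx.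
  have ss : size s = n by apply/eqP; apply: (allP wX).
  have Xs := perm_to_rem sXin.
  have wX' : all_size n (seq.rem s X) by apply/allP => u /mem_rem; apply: (allP wX).
  have sX' : size (seq.rem s X) <= k by rewrite size_rem //; case: (X) sX sXin.
  have [R [Z [RL XRZ]]] := IH _ _ wX' sX' (hits_all_remove ss (hits_all_perm Xs tX)).
  exists (s :: R), Z; split; last by rewrite (perm_trans Xs) //= perm_cons.
  apply/flattenP; exists [seq s :: R | R <- solve n k (remove s t)]; last by apply: map_f.
  apply/mapP; exists s; first exact: mem_hitters.
  rewrite N_ltbE Nnat.N2Nat.inj_add Nnat.N2Nat.inj_mul Nnat.Nat2N.id npointsE weightsE //.
  rewrite ltnNge (_ : (_ <= _) = true) //.
  apply: leq_trans H2 _.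
  rewrite (perm_big _ Xs) big_cons -[X in _ <= X]/(num_hit n t s + k * m) leq_add2l.
  have Wm' u : u \in seq.rem s X -> num_hit n t u <= m by move/mem_rem; apply: Wm.
  by apply: leq_trans (sum_le_const Wm') _; rewrite leq_mul2r sX' orbT.
- by exists [::], X; rewrite mem_head perm_refl.
Qed.

(** * Slicing by the first letter and gluing slices *)

Definition remove_all (X : seq word) (t : tree bool) := foldl (fun t s => remove s t) t X.
Lemma get_remove_all n X t x : all_size n X -> size x = n ->
  get (remove_all X t) x = get t x && ~~ has (hits^~ x) X.
Proof.
elim: X t => [|s X IH] t; first by rewrite /= andbT.
move=> /= /andP[/eqP ss wX] sx; rewrite IH // get_remove ?ss ?sx //.
by rewrite negb_or andbA.
Qed.

(** One pass over [P], keeping the words that no element has hit so far and those that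
    exactly one element has hit. *)
Definition once_step (zu : tree bool * tree bool) s :=
  (remove s zu.1, zip_tree orb (remove s zu.2) (restrict s zu.1)).
Definition once (P : seq word) := (foldl once_step (full, Leaf false) P).2.
Lemma get_once n P x : all_size n P -> size x = n ->
  get (once P) x = (count (hits^~ x) P == 1).
Proof.
move=> wP sx; rewrite /once.
suff H zu k : get zu.1 x = (k == 0) -> get zu.2 x = (k == 1) ->
   get (foldl once_step zu P).2 x = (count (hits^~ x) P + k == 1).
  by rewrite (H _ 0) // addn0.
elim: P wP zu k => [|s P IH] //= /andP[/eqP ss wP] zu k H0 H1.
rewrite (IH wP _ (hits s x + k)) /=; first by rewrite addnA [count _ _ + _]addnC.
  by rewrite get_remove ?ss // H0; case: (hits s x); rewrite ?andbF ?andbT.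
rewrite get_zip_tree get_remove ?get_restrict ?ss // H0 H1.
by case: (hits s x); case: k {H0 H1} => [|[]].
Qed.

Definition tails (p : pred letter) (X : seq word) := [seq behead w | w <- X & p (head La w)].
Definition others b X := tails (predC1 b) X.
Lemma tails_size n p X : all_size n.+1 X -> all_size n (tails p X).
Proof.
move=> /allP wX; apply/allP => w /mapP[v]; rewrite mem_filter => /andP[_ /wX /eqP sv] ->.
by rewrite size_behead sv.
Qed.
Lemma perm_tails p X Y : perm_eq X Y -> perm_eq (tails p X) (tails p Y).
Proof. by move=> XY; apply: perm_map; apply: perm_filter. Qed.
Lemma count_others n X l x : all_size n.+1 X ->
  count (hits^~ (l :: x)) X = count (hits^~ x) (others l X).
Proof.
elim: X => [|[|m w] X IH] //= /andP[/eqP[sw] wX]; rewrite /others /tails /= IH //.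
by rewrite -[eql m l]/(m == l); case: (m == l) => /=.
Qed.
Lemma hits_all_others n t b X : all_size n.+1 X -> hits_all n.+1 t X ->
  hits_all n (child b t) (others b X).
Proof.
move=> wX tX x sx; rewrite get_child => tx.
have := tX (b :: x); rewrite /= sx => /(_ erefl tx).
by rewrite !has_count (count_others _ _ wX).
Qed.
Lemma get_once_others n b P x : all_size n.+1 P -> size x = n ->
  get (child b (once P)) x = get (once (others b P)) x.
Proof.
move=> wP sx; rewrite get_child (@get_once n.+1) //= ?sx // (@get_once n) ?tails_size //.
by rewrite (count_others _ _ wP).
Qed.
Lemma size_others b (X : seq word) :
  size (others b X) + count (fun w => head La w == b) X = size X.
Proof. by rewrite size_map size_filter addnC count_predC. Qed.
Lemma sum_heads (X : seq word) : count (fun w => head La w == La) X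
  + count (fun w => head La w == Lb) X + count (fun w => head La w == Lc) X = size X.
Proof.
elim: X => //= w X IH; rewrite -[in RHS]IH; by case: (head La w) => /=; lia.
Qed.
(** Some first letter occurs in at least a third of the words. *)
Lemma small_others k m (X : seq word) : size X <= k -> 2 * k < 3 * m.+1 ->
  exists b, size (others b X) <= m.
Proof.
move=> sX km.
have H b := size_others b X; have := sum_heads X.
have := H La; have := H Lb; have := H Lc => Hc Hb Ha Hs.
case: (leqP (size (others La X)) m) => [|ga]; first by exists La.
case: (leqP (size (others Lb X)) m) => [|gb]; first by exists Lb.
by exists Lc; lia.
Qed.
Lemma perm_heads b (X : seq word) : perm_eq (map behead X) (others b X ++ tails (pred1 b) X).
Proof.
rewrite /others /tails -map_cat; apply: perm_map.
by rewrite perm_sym perm_catC perm_filterC.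
Qed.

Definition remove_slabs (w : word) (t : tree bool) :=
  Node (remove w (child La t)) (remove w (child Lb t)) (remove w (child Lc t)).
Lemma get_remove_slabs w t l x : size x = size w ->
  get (remove_slabs w t) (l :: x) = get t (l :: x) && ~~ hits w x.
Proof. by move=> sx; rewrite -get_child; case: l => /=; rewrite get_remove ?get_child. Qed.

(** All ways of prefixing a letter of [ls] to each word of [T] so that [t] is hit.  A
    branch is dropped once the undecided tails, counted with all first letters at once,
    leave something of [t] unhit. *)
Fixpoint lifts n (ls : seq letter) (T : seq word) (t : tree bool) : seq (seq word) :=
  if empty n.+1 (foldl (fun t w => remove_slabs w t) t T) then
    if T is w :: T then
      flatten [seq [seq (l :: w) :: Y | Y <- lifts n ls T (remove (l :: w) t)] | l <- ls]
    else [:: [::]]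
  else [::].
Lemma remove_slabs_empty n T t Y : map behead Y = T -> all_size n.+1 Y -> hits_all n.+1 t Y ->
  empty n.+1 (foldl (fun t w => remove_slabs w t) t T).
Proof.
move=> <- wY tY; apply/emptyP => -[|l x] // [sx].
have H : get (foldl (fun t w => remove_slabs w t) t (map behead Y)) (l :: x)
   = get t (l :: x) && ~~ has (fun y => hits (behead y) x) Y.
  elim: Y wY t {tY} => [|y Y IH] /=; first by move=> _ t; rewrite andbT.
  case/andP=> /eqP sy wY t; rewrite IH // get_remove_slabs ?size_behead ?sy ?sx //.
  by rewrite negb_or andbA.
rewrite H; case tx: (get t _) => //=; apply/negbTE; rewrite negbK.
have sx1 : size (l :: x) = n.+1 by rewrite /= sx.
have /hasP[y yY yx] := tY _ sx1 tx; apply/hasP; exists y => //.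
by case: y yx {yY} => //= m y; case: (eql m l).
Qed.
Lemma mem_lifts n ls T t Y : map behead Y = T -> all_size n.+1 Y -> hits_all n.+1 t Y ->
  all (fun y => head La y \in ls) Y -> Y \in lifts n ls T t.
Proof.
elim: T t Y => [|w T IH] t Y eT wY tY hY; have eY := remove_slabs_empty eT wY tY.
  by rewrite /= in eY *; rewrite eY; case: Y eT {wY tY hY eY}.
rewrite [lifts _ _ _ _]/= -/(foldl _ _ (w :: T)) eY.
case: Y eT wY tY hY {eY} => // -[|l y] Y // [<- eT] /= /andP[/eqP[sy] wY] tY /andP[hl hY].
apply/flattenP; exists [seq (l :: y) :: Y | Y <- lifts n ls T (remove (l :: y) t)].
  by apply/mapP; exists l.
apply: map_f; apply: IH => //; apply: (hits_all_remove (s := l :: y)) => //.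
by rewrite /= sy.
Qed.

Lemma perm_map_lift (A B : eqType) (f : A -> B) X L : perm_eq (map f X) L ->
  exists Y, perm_eq X Y /\ map f Y = L.
Proof.
elim: L X => [|u L IH] X XL.
  by exists [::]; case: X XL => //= x X /perm_size.
have : u \in map f X by rewrite (perm_mem XL) mem_head.
case/mapP=> x xX ex.
have Xx := perm_to_rem xX.
have : perm_eq (map f (seq.rem x X)) L.
  rewrite -(perm_cons u) -(permPr XL) ex -map_cons perm_sym.
  by apply: perm_map.
case/IH => Y [XY eY]; exists (x :: Y); split; last by rewrite /= eY ex.
by rewrite (permPl Xx) perm_cons.
Qed.

Fixpoint fill n (m : nat) (T : seq word) : seq (seq word) :=
  if m is m.+1 then T :: flatten [seq fill n m (rcons T w) | w <- words n] else [:: T].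
Lemma mem_fill n m T Z : all_size n Z -> size Z <= m -> T ++ Z \in fill n m T.
Proof.
elim: m T Z => [|m IH] T [|z Z] //=; rewrite ?cats0 ?mem_head ?mem_seq1 //.
case/andP=> sz wZ sZ; rewrite inE; apply/orP; right; apply/flattenP.
exists (fill n m (rcons T z)); first by apply: map_f; rewrite mem_words.
by rewrite -cat_rcons IH.
Qed.
Definition rest b (t : tree bool) :=
  match b with
  | La => zip_tree orb (child Lb t) (child Lc t)
  | Lb => zip_tree orb (child La t) (child Lc t)
  | Lc => zip_tree orb (child La t) (child Lb t)
  end.
Lemma get_rest b t x : get (rest b t) x -> exists2 l, l != b & get (child l t) x.
Proof.
case: b; rewrite get_zip_tree => /orP[H|H];
 [by exists Lb|by exists Lc|by exists La|by exists Lc|by exists La|by exists Lb].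
Qed.

(** To hit [t] with [k] words, the words that do not start with [b] must hit the slice
    [child b t]; their tails are looked up in the list [L] for that slice.  The tails of
    all words must hit the two other slices, which bounds the tails still missing.  Only
    then are the first letters chosen.  Looking up slices that have been searched before
    is what makes dimensions 5 to 7 accessible. *)
Definition glue_tails n k b t (L : seq (seq word)) :=
  flatten [seq [seq R ++ Z | Z <- solve n (k - size R) (remove_all R (rest b t))] | R <- L].
Definition glue n k b t (L : seq (seq word)) :=
  flatten [seq flatten [seq lifts n letters U t | U <- fill n (k - size T) T]
          | T <- glue_tails n k b t L].
Lemma glue_complete n m k b t L X : complete n (child b t) m L -> all_size n.+1 X ->
  size X <= k -> size (others b X) <= m -> hits_all n.+1 t X ->
  exists Y : seq word, Y \in glue n k b t L /\ perm_eq X Y.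
Proof.
move=> cL wX sX soX tX.
have [R [Q [RL oRQ]]] := cL _ (tails_size _ wX) soX (hits_all_others wX tX).
pose X' := Q ++ tails (pred1 b) X.
have perm1 : perm_eq (map behead X) (R ++ X').
  by rewrite (permPl (perm_heads b X)) /X' catA perm_cat2r.
have wb : all_size n (map behead X).
  by apply/allP => w /mapP[v /(allP wX) /eqP sv ->]; rewrite size_behead sv.
have wRX : all_size n (R ++ X') by rewrite /all_size -(perm_all _ perm1).
have wR : all_size n R by move: wRX; rewrite /all_size all_cat => /andP[].
have wX' : all_size n X' by move: wRX; rewrite /all_size all_cat => /andP[].
have sRX : size R + size X' <= k by rewrite -size_cat -(perm_size perm1) size_map.
have cX' : hits_all n (remove_all R (rest b t)) X'.
  move=> x sx; rewrite (get_remove_all _ wR) // => /andP[/get_rest[l _ lx] nR].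
  have := tX (l :: x); rewrite /= sx -get_child => /(_ erefl lx) /hasP[s sXin].
  case: s sXin => //= l' s sXin; case: ifP => // _ sx'.
  have : has (hits^~ x) (R ++ X').
    by rewrite -(perm_has _ perm1) has_map; apply/hasP; exists (l' :: s).
  by rewrite has_cat (negbTE nR).
have sX' : size X' <= k - size R by rewrite leq_subRL // (leq_trans (leq_addr _ _) sRX).
have [Z [Z' [Zin ZZ]]] := solve_complete wX' sX' cX'.
have perm2 : perm_eq (map behead X) ((R ++ Z) ++ Z').
  by rewrite (permPl perm1) -catA perm_cat2l.
have sZ : size (R ++ Z) + size Z' <= k by rewrite -size_cat -(perm_size perm2) size_map.
have [Y [XY eY]] := perm_map_lift perm2.
exists Y; split=> //; apply/flattenP.
exists (flatten [seq lifts n letters U t | U <- fill n (k - size (R ++ Z)) (R ++ Z)]).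
  apply: map_f; apply/flattenP.
  exists [seq R ++ Z | Z <- solve n (k - size R) (remove_all R (rest b t))].
    by apply: (map_f (fun R => [seq R ++ Z | Z <- solve n (k - size R) (remove_all R (rest b t))])).
  exact: map_f.
apply/flattenP; exists (lifts n letters ((R ++ Z) ++ Z') t).
  apply: (map_f (fun U => lifts n letters U t)); apply: mem_fill.
    by move: wb; rewrite /all_size (perm_all _ perm2) all_cat => /andP[].
  by rewrite leq_subRL // (leq_trans (leq_addr _ _) sZ).
apply: mem_lifts => //.
- by rewrite /all_size -(perm_all _ XY).
- exact: hits_all_perm tX.
- by apply/allP => y _; case: (head La y).
Qed.

Lemma complete_eq n t u k L : (forall x, size x = n -> get t x = get u x) ->
  complete n t k L -> complete n u k L.
Proof.
move=> tu cL X wX sX uX; apply: cL => // x sx tx; apply: uX => //; by rewrite -tu.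
Qed.
Lemma complete_others n b P m L : all_size n.+1 P -> complete n (once (others b P)) m L ->
  complete n (child b (once P)) m L.
Proof. by move=> wP; apply: complete_eq => x sx; rewrite (@get_once_others n). Qed.
Lemma complete_size n t k L X : complete n t k L -> all (fun R => size R == k) L ->
  all_size n X -> size X = k -> hits_all n t X -> exists2 R, R \in L & perm_eq X R.
Proof.
move=> cL /allP sL wX sX cX; have [|R [Z [RL XRZ]]] := cL X wX _ cX; first by rewrite sX.
exists R => //; have := perm_size XRZ; rewrite size_cat sX (eqP (sL R RL)) -[in LHS](addn0 k).
by move/addnI; case: Z XRZ; rewrite ?cats0.
Qed.
Lemma perm_sub (R Y : seq word) : uniq R -> {subset R <= Y} ->
  exists Z : seq word, perm_eq Y (R ++ Z).
Proof.
elim: R Y => [|r R IH] Y /=; first by exists Y; rewrite perm_refl.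
case/andP=> rR uR RY; have rY : r \in Y by rewrite RY ?mem_head.
have [|Z YZ] := IH (seq.rem r Y) uR.
  move=> s sR; have : s \in Y by rewrite RY ?inE ?sR ?orbT.
  rewrite (perm_mem (perm_to_rem rY)) inE => /orP[/eqP e|//].
  by rewrite e in sR; rewrite sR in rR.
by exists Z; rewrite (permPl (perm_to_rem rY)) perm_cons.
Qed.
Definition refines (L M : seq (seq word)) :=
  all (fun Y => has (fun R => uniq R && all (mem Y) R) M) L.
Lemma complete_refines n t k L M : refines L M -> complete n t k L -> complete n t k M.
Proof.
move=> /allP LM cL X wX sX tX; have [Y [Z [YL XY]]] := cL X wX sX tX.
have /hasP[R RM /andP[uR /allP RY]] := LM Y YL.
have [Z' YZ] := perm_sub uR RY.
exists R, (Z' ++ Z); split => //; by rewrite (permPl XY) catA perm_cat2r.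
Qed.

Definition glue_once n m k P :=
  flatten [seq glue n k b (once P) (solve n m (once (others b P))) | b <- letters].
Lemma glue_once_complete n m k P : all_size n.+1 P -> 2 * k < 3 * m.+1 ->
  complete n.+1 (once P) k (glue_once n m k P).
Proof.
move=> wP km X wX sX tX; have [b sb] := small_others sX km.
have cb := complete_others wP (@solve_complete n m (once (others b P))).
have [Y [Yin XY]] := glue_complete cb wX sX sb tX.
exists Y, [::]; rewrite cats0; split => //; apply/flattenP.
exists (glue n k b (once P) (solve n m (once (others b P)))) => //.
by apply: (map_f (fun b => glue n k b (once P) (solve n m (once (others b P))))); case: (b).
Qed.

(** * Covers, symmetries and normal forms *)

Definition is_cover n S := all_size n S /\ hits_all n full S.
Definition isom n (f : word -> word) :=
  (forall w, size w = n -> size (f w) = n) /\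
  (forall s x, size s = n -> size x = n -> hits (f s) (f x) = hits s x).

Lemma hits_inj n s s' : size s = n -> size s' = n ->
  (forall x, size x = n -> hits s x = hits s' x) -> s = s'.
Proof.
move: n s s'; elim=> [|n IH] [|l s] [|l' s'] //= [ss] [ss'] H.
have hit_some (u : word) : hits u [seq (if eql l La then Lb else La) | l <- u].
  by elim: u => // -[] u.
have E : l = l'.
  have := H (l :: [seq (if eql l La then Lb else La) | l <- s']).
  have := H (l' :: [seq (if eql l La then Lb else La) | l <- s]).
  rewrite /= !size_map ss ss' !hit_some => /(_ erefl) + /(_ erefl).
  by case: l {H}; case: l'.
rewrite -E in H *; congr cons; apply: IH => // y sy.
by have := H ((if eql l La then Lb else La) :: y); rewrite /= sy => /(_ erefl); case: (l).
Qed.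
(** An isomorphism is injective because a word is determined by the words it hits, and
    then surjective because words of a given length are finite in number. *)
Lemma isom_surj n f x : isom n f -> size x = n -> exists2 y, size y = n & f y = x.
Proof.
case=> fs fh sx.
have fi : {in words n &, injective f}.
  move=> u v; rewrite !mem_words => /eqP su /eqP sv e; apply: (hits_inj su sv) => z sz.
  by rewrite -(fh u z) // -(fh v z) // e.
have uf : uniq (map f (words n)) by rewrite map_inj_in_uniq ?uniq_words.
have sub : {subset map f (words n) <= words n}.
  by move=> v /mapP[u]; rewrite !mem_words => /eqP su ->; rewrite fs.
have [|_ E] := uniq_min_size uf sub; first by rewrite size_map.
have : x \in map f (words n) by rewrite E mem_words sx eqxx.
by case/mapP => y; rewrite mem_words => /eqP sy ->; exists y.
Qed.
Lemma isom_comp n f g : isom n f -> isom n g -> isom n (f \o g).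
Proof.
case=> fs fh [gs gh]; split=> [w sw|s x ss sx] /=; first by rewrite fs ?gs.
by rewrite fh ?gs ?gh.
Qed.
Lemma isom_size n f X : isom n f -> all_size n X -> all_size n (map f X).
Proof. by case=> fs _ /allP wX; apply/allP => w /mapP[v /wX /eqP sv ->]; rewrite fs. Qed.
Lemma count_isom n f X x : isom n f -> all_size n X -> size x = n ->
  count (hits^~ (f x)) (map f X) = count (hits^~ x) X.
Proof.
move=> [_ fh] /allP wX sx; rewrite count_map; apply: eq_in_count => s sX /=.
by rewrite fh //; apply/eqP/wX.
Qed.
Lemma is_cover_isom n f S : isom n f -> is_cover n S -> is_cover n (map f S).
Proof.
move=> If [wS cS]; split=> [|x sx _]; first exact: isom_size.
have [y sy <-] := isom_surj If sx.
by rewrite has_count (count_isom If) // -has_count; apply: cS.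
Qed.
Lemma is_cover_perm n S Q : perm_eq S Q -> is_cover n S -> is_cover n Q.
Proof.
by move=> SQ [wS cS]; split; [rewrite /all_size -(perm_all _ SQ)|apply: hits_all_perm cS].
Qed.
Lemma is_cover_others n b S : is_cover n.+1 S -> is_cover n (others b S).
Proof.
by case=> wS cS; split; [apply: tails_size|exact: (@hits_all_others n full b)].
Qed.

Definition hits_once n P X := hits_all n (once P) X.
Lemma hits_once_isom n f P X : isom n f -> all_size n X -> all_size n P ->
  hits_once n P X -> hits_once n (map f P) (map f X).
Proof.
move=> If wX wP cX x sx; have [y sy <-] := isom_surj If sx.
rewrite (get_once (isom_size If wP)) ?(If.1) // (count_isom If) // has_count (count_isom If) //.
by rewrite -(get_once wP) // -has_count; apply: cX.
Qed.
Lemma hits_once_perm n P Q X : perm_eq P Q -> all_size n P -> hits_once n P X -> hits_once n Q X.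
Proof.
move=> PQ wP; have wQ : all_size n Q by rewrite /all_size -(perm_all _ PQ).
by move=> cX x sx; rewrite (get_once wQ) // -(permP PQ) -(get_once wP) //; apply: cX.
Qed.

(** A symmetry of the set of words: each new coordinate is read off an old one through a
    permutation of the letters, itself given by its values at La, Lb and Lc. *)
Definition lperm := (letter * letter * letter)%type.
Definition ap (s : lperm) l := match l with La => s.1.1 | Lb => s.1.2 | Lc => s.2 end.
Definition idp : lperm := (La, Lb, Lc).
Definition lperms : seq lperm :=
  [:: idp; (La, Lc, Lb); (Lb, La, Lc); (Lb, Lc, La); (Lc, La, Lb); (Lc, Lb, La)].
Definition act (g : seq (nat * lperm)) (w : word) : word := [seq ap p.2 (nth La w p.1) | p <- g].
Definition valid n (g : seq (nat * lperm)) :=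
  perm_eq (map fst g) (iota 0 n) && all (fun p => p.2 \in lperms) g.
Lemma ap_inj s : s \in lperms -> injective (ap s).
Proof. by rewrite !inE => /or4P[|||/or3P[]] /eqP-> [] []. Qed.
Lemma act_isom n g : valid n g -> isom n (act g).
Proof.
case/andP=> pg /allP ag; have sg : size g = n by rewrite -(size_map fst) (perm_size pg) size_iota.
split=> [w _|s x ss sx]; first by rewrite size_map.
rewrite !hitsE ?size_map ?ss ?sx // sg -[RHS](perm_all _ pg) all_map.
pose d : nat * lperm := (0, idp).
have E w i : i < n -> nth La (act g w) i = ap (nth d g i).2 (nth La w (nth d g i).1).
  by move=> ig; rewrite (nth_map d) ?sg.
have inj i : i < n -> injective (ap (nth d g i).2).
  by move=> ig; apply: ap_inj; apply: ag; rewrite mem_nth ?sg.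
apply/allP/allP => H.
  move=> p pin; have [i] := nthP d pin; rewrite sg => ig ep.
  by have := H i; rewrite mem_iota /= add0n ig => /(_ isT); rewrite !E // (inj_eq (inj _ ig)) ep.
move=> i; rewrite mem_iota /= add0n => ig.
by rewrite !E // (inj_eq (inj _ ig)); apply: (H (nth d g i)); rewrite mem_nth ?sg.
Qed.

Fixpoint delete (u : word) (L : seq word) : option (seq word) :=
  if L is v :: L then
    if u == v then Some L else if delete u L is Some L' then Some (v :: L') else None
  else None.
Fixpoint same (L M : seq word) : bool :=
  if L is u :: L then if delete u M is Some M' then same L M' else false else nilp M.
Definition first_some A B (f : A -> option B) :=
  fix first s := if s is x :: s then if f x is Some y then Some y else first s else None.
(** Backtracking on the coordinates of the target: [targets] lists its reversed prefixes
    by increasing length, [pre] holds the prefixes built so far, and [av] the source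
    coordinates still free.  The symmetry found is verified afterwards. *)
Fixpoint find_isom (S pre : seq word) (targets : seq (seq word)) (av : seq nat)
    : option (seq (nat * lperm)) :=
  if targets is tg :: targets then
    first_some (fun j => first_some (fun s =>
      let pre' := [seq ap s (nth La p.2 j) :: p.1 | p <- zip pre S] in
      if same pre' tg then
        if find_isom S pre' targets (seq.rem j av) is Some g then Some ((j, s) :: g) else None
      else None) lperms) av
  else Some [::].
Definition isomorphic n S Q :=
  if find_isom S [seq [::] | _ <- S] [seq [seq rev (take k.+1 t) | t <- Q] | k <- iota 0 n] (iota 0 n)
  is Some g then valid n g && perm_eq (map (act g) S) Q else false.
(** Two lists are moved at once by marking their words with different first letters. *)
Definition mark (X P : seq word) := [seq La :: x | x <- X] ++ [seq Lb :: p | p <- P].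
Definition isomorphic2 n X P Y Q :=
  if find_isom (mark X P) [seq take 1 w | w <- mark X P]
     [seq [seq rev (take k.+1 t) | t <- mark Y Q] | k <- iota 1 n] (iota 1 n)
  is Some g then let g := [seq (p.1.-1, p.2) | p <- g] in
    [&& valid n g, perm_eq (map (act g) X) Y & perm_eq (map (act g) P) Q] else false.

Definition equiv n (S Q : seq word) := exists f, isom n f /\ perm_eq (map f S) Q.
Lemma isomorphicP n S Q : isomorphic n S Q -> equiv n S Q.
Proof.
rewrite /isomorphic; case: find_isom => // g /andP[vg p].
by exists (act g); split => //; apply: act_isom.
Qed.
Lemma isomorphic2P n X P Y Q : isomorphic2 n X P Y Q ->
  exists f, [/\ isom n f, perm_eq (map f X) Y & perm_eq (map f P) Q].
Proof.
rewrite /isomorphic2; case: find_isom => // g /= /and3P[vg p q].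
by eexists; split; [exact: act_isom vg| |].
Qed.
Lemma equiv_perm n S Q : perm_eq S Q -> equiv n S Q.
Proof. by move=> p; exists id; split; last rewrite map_id. Qed.
Lemma equiv_trans n S Q U : equiv n S Q -> equiv n Q U -> equiv n S U.
Proof.
case=> f [If pf] [g [Ig pg]]; exists (g \o f); split; first exact: isom_comp.
by rewrite map_comp (permPl (perm_map g pf)).
Qed.
Lemma equiv_map n f S P : isom n f -> equiv n (map f S) P -> equiv n S P.
Proof. by move=> If; apply: equiv_trans; exists f. Qed.

Definition on_cons (s : lperm) (f : word -> word) (w : word) :=
  if w is l :: w then ap s l :: f w else [::].
Lemma isom_cons n s f : s \in lperms -> isom n f -> isom n.+1 (on_cons s f).
Proof.
move=> sp [fs fh]; split=> [[|l w] //= [sw]|[|l w] [|m x] //= [sw] [sx]]; first by rewrite fs.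
by rewrite -![eql _ _]/(_ == _) (inj_eq (ap_inj sp)) fh.
Qed.

Definition assemble (X A B : seq word) := map (cons La) X ++ map (cons Lb) A ++ map (cons Lc) B.
Lemma assemble_size n X A B :
  all_size n.+1 (assemble X A B) = [&& all_size n X, all_size n A & all_size n B].
Proof. by rewrite /all_size !all_cat !all_map; congr [&& _, _ & _]; apply: eq_all => w /=; rewrite eqSS. Qed.
Lemma map_assemble f X A B :
  map (on_cons idp f) (assemble X A B) = assemble (map f X) (map f A) (map f B).
Proof. by rewrite /assemble !map_cat -!map_comp. Qed.
Lemma perm_assemble n X : all_size n.+1 X ->
  perm_eq X (assemble (tails (pred1 La) X) (tails (pred1 Lb) X) (tails (pred1 Lc) X)).
Proof.
move=> wX; rewrite /assemble /tails -!map_comp.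
have E l : [seq (cons l \o behead) w | w <- X & head La w == l] = [seq w <- X | head La w == l].
  rewrite -[RHS]map_id; apply/eq_in_map => w; rewrite mem_filter => /andP[/eqP <-].
  by move/(allP wX); case: w.
rewrite !E perm_sym; apply/permP => p; rewrite !count_cat !count_filter.
elim: X {wX E} => //= w X <-; by case: (head La w) => /=; case: (p w) => /=; lia.
Qed.
Lemma others_assemble X A B :
  [/\ others La (assemble X A B) = A ++ B, others Lb (assemble X A B) = X ++ B
    & others Lc (assemble X A B) = X ++ A].
Proof.
have F l m (Y : seq word) : [seq behead w | w <- map (cons l) Y & predC1 m (head La w)]
    = if l == m then [::] else Y.
  elim: Y => [|y Y IH] /=; first by case: (l == m).
  by case: (l == m) IH => /= ->.
by rewrite /others /tails /assemble; split; rewrite !filter_cat !map_cat !F ?cats0.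
Qed.
Lemma assemble_cover n X A B : is_cover n.+1 (assemble X A B) ->
  [/\ all_size n X, is_cover n (A ++ B), is_cover n (X ++ A) & is_cover n (X ++ B)].
Proof.
move=> cS; have [e1 e2 e3] := others_assemble X A B.
have H b := is_cover_others b cS; split; [|by rewrite -e1|by rewrite -e3|by rewrite -e2].
by have := cS.1; rewrite assemble_size => /andP[].
Qed.
Lemma assemble_cover_map n f X A B : isom n f -> is_cover n.+1 (assemble X A B) ->
  is_cover n.+1 (assemble (map f X) (map f A) (map f B)).
Proof. by move=> If; rewrite -map_assemble; apply: is_cover_isom; apply: isom_cons. Qed.
Lemma equiv_assemble n f X A B Q : isom n f ->
  equiv n.+1 (assemble (map f X) (map f A) (map f B)) Q -> equiv n.+1 (assemble X A B) Q.
Proof. by move=> If; rewrite -map_assemble; apply: equiv_map; apply: isom_cons. Qed.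

(** The most frequent first letter is renamed La. *)
Lemma normal_form n S : is_cover n.+1 S ->
  exists f X A B, [/\ isom n.+1 f, perm_eq (map f S) (assemble X A B),
    is_cover n.+1 (assemble X A B),
    3 * size (A ++ B) <= 2 * size S & size X + size (A ++ B) = size S].
Proof.
move=> cS; have wS := cS.1.
have [b sb] : exists b, size (others b S) <= (2 * size S) %/ 3.
  by apply: (@small_others (size S)) => //; rewrite [(3 * _)%N]mulnC ltn_ceil.
pose s : lperm := match b with La => idp | Lb => (Lb, La, Lc) | Lc => (Lc, Lb, La) end.
have sp : s \in lperms by rewrite /s; case: (b).
have If : isom n.+1 (on_cons s id) by apply: isom_cons.
set S' := map (on_cons s id) S; have cS' : is_cover n.+1 S' by apply: is_cover_isom.
exists (on_cons s id), (tails (pred1 La) S'), (tails (pred1 Lb) S'), (tails (pred1 Lc) S').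
have P := perm_assemble cS'.1.
have sS : size S' = size S by rewrite size_map.
have sAB : size (tails (pred1 Lb) S' ++ tails (pred1 Lc) S') = size (others b S).
  have [e1 _ _] := others_assemble (tails (pred1 La) S') (tails (pred1 Lb) S') (tails (pred1 Lc) S').
  rewrite -e1 -(perm_size (perm_tails _ P)) !size_map !size_filter /S' count_map.
  apply: eq_in_count => w wS' /=; case: w wS' => [/(allP wS)|l w _] //=.
  by rewrite /s; case: (b); case: l.
split=> //; first exact: is_cover_perm cS'; first by rewrite sAB mulnC -leq_divRL.
by rewrite -sS (perm_size P) /assemble !size_cat !size_map.
Qed.

(** [P] is, up to symmetry, the only cover with as many words; as repeating a word of a
    smaller cover would give another, [P] is then also of minimum size. *)
Definition unique_cover n P := [/\ all_size n P, uniq P &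
  forall S, is_cover n S -> size S = size P -> equiv n S P].
Lemma unique_cover_min n P S : unique_cover n P -> is_cover n S -> size P <= size S.
Proof.
case=> wP uP HP [wS cS]; rewrite leqNgt; apply/negP => lt.
have [s sS] : exists s, s \in S.
  by have /hasP[s sS _] := cS (nseq n La) (size_nseq _ _) isT; exists s.
pose S' := nseq (size P - size S) s ++ S.
have cS' : is_cover n S'.
  split=> [|x sx tx]; last by rewrite has_cat cS ?orbT.
  by rewrite /all_size all_cat all_nseq (allP wS) // orbT; exact: wS.
have sS' : size S' = size P by rewrite size_cat size_nseq subnK // ltnW.
have [f [_ pf]] := HP S' cS' sS'.
have := uP; rewrite -(perm_uniq pf) => /map_uniq.
rewrite cat_uniq => /and3P[_ nS _]; have /hasPn/(_ s sS) := nS.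
by rewrite mem_nseq eqxx andbT subn_gt0 lt.
Qed.

(** * Extending covers by one dimension *)

(** The covers whose words with first letter La have tails [X], and whose other words
    have tails [P]: the two other slices must cover what [X] leaves. *)
Definition extensions n (P X : seq word) :=
  let D := remove_all X full in
  [seq map (cons La) X ++ Y | Y <- lifts n [:: Lb; Lc] P (Node (Leaf false) D D)].
Lemma mem_extensions n P X A B : is_cover n.+1 (assemble X A B) -> perm_eq (A ++ B) P ->
  exists Q, Q \in extensions n P X /\ perm_eq (assemble X A B) Q.
Proof.
move=> cS ABP; have [wX _ [_ cXA] [_ cXB]] := assemble_cover cS.
have := cS.1; rewrite assemble_size => /and3P[_ wA wB].
pose Z := map (cons Lb) A ++ map (cons Lc) B.
have : perm_eq (map behead Z) P by rewrite /Z map_cat -!map_comp !map_id.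
case/perm_map_lift => Y [ZY eY].
exists (map (cons La) X ++ Y); split; last by rewrite /assemble perm_cat2l.
apply: map_f; apply: mem_lifts => //.
- rewrite /all_size -(perm_all _ ZY) all_cat !all_map.
  by apply/andP; split; apply/allP => w /=; rewrite eqSS; [apply: (allP wA)|apply: (allP wB)].
- apply: (hits_all_perm ZY) => -[|l x] // [sx] /=.
  case: l; rewrite /get -/get //; rewrite (get_remove_all _ wX) //= => nX;
    rewrite has_cat !has_map.
    have := cXB x sx isT; rewrite has_cat (negbTE nX) /= => H.
    by apply/orP; right; apply: sub_has H => y.
  have := cXA x sx isT; rewrite has_cat (negbTE nX) /= => H.
  by apply/orP; left; apply: sub_has H => y.
- rewrite -(perm_all _ ZY) all_cat !all_map; apply/andP.
  by split; apply/allP => w.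
Qed.
Lemma extension_perm n P X R A B : is_cover n.+1 (assemble X A B) ->
  perm_eq (A ++ B) P -> perm_eq X R ->
  exists Q, Q \in extensions n P R /\ perm_eq (assemble X A B) Q.
Proof.
move=> cS ABP XR.
have pXR : perm_eq (assemble X A B) (assemble R A B).
  by rewrite /assemble perm_cat2r; apply: perm_map.
have [Y [Yin pY]] := mem_extensions (is_cover_perm pXR cS) ABP.
by exists Y; rewrite (permPl pXR).
Qed.

(** A point hit once by the two slices A and B together is not hit by one of them; the
    third slice must hit it, for the cover to work over the letter of the other one. *)
Lemma third_hits_once n P X A B : is_cover n.+1 (assemble X A B) -> perm_eq (A ++ B) P ->
  hits_once n P X.
Proof.
move=> cS ABP; have [wX [wAB _] [_ cXA] [_ cXB]] := assemble_cover cS.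
apply: (hits_once_perm ABP) => // x sx; rewrite (get_once wAB) // count_cat => /eqP.
have := cXA x sx isT; have := cXB x sx isT; rewrite !has_cat ![has _ A]has_count ![has _ B]has_count.
by case: (has _ X) => //=; lia.
Qed.
Lemma normalize n P S : unique_cover n P -> is_cover n.+1 S -> 2 * size S < 3 * (size P).+1 ->
  exists f X A B, [/\ isom n.+1 f, perm_eq (map f S) (assemble X A B),
    is_cover n.+1 (assemble X A B), perm_eq (A ++ B) P & size X = size S - size P].
Proof.
move=> uP cS sS; have [f [X [A [B [If pf cT s1 s2]]]]] := normal_form cS.
have [_ cAB _ _] := assemble_cover cT; have min := unique_cover_min uP cAB.
have e : size (A ++ B) = size P.
  by apply/eqP; rewrite eqn_leq min andbT -ltnS -(ltn_pmul2l (isT : 0 < 3)) (leq_ltn_trans s1).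
have [_ _ HP] := uP; have [g [Ig pg]] := HP _ cAB e.
exists (on_cons idp g \o f), (map g X), (map g A), (map g B); split.
- by apply: isom_comp => //; apply: isom_cons.
- by rewrite map_comp -map_assemble; apply: perm_map.
- exact: assemble_cover_map.
- by rewrite -map_cat.
- by rewrite size_map -s2 e addnK.
Qed.

Definition extend_to n P L Q :=
  all (fun R => all (fun S => isomorphic n.+1 S Q) (extensions n P R)) L.
Lemma extend_to_equiv n k P L Q X A B :
  complete n (once P) k L -> all (fun R => size R == k) L -> extend_to n P L Q ->
  is_cover n.+1 (assemble X A B) -> perm_eq (A ++ B) P ->
  size X = k -> equiv n.+1 (assemble X A B) Q.
Proof.
move=> cL sL /allP ok cS ABP sX; have [wX _ _ _] := assemble_cover cS.
have [R RL XR] := complete_size cL sL wX sX (third_hits_once cS ABP).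
have [Y [Yin pY]] := extension_perm cS ABP XR.
apply: equiv_trans (isomorphicP (allP (ok R RL) Y Yin)); exact: equiv_perm.
Qed.
Definition next_ok n (P Q : seq word) :=
  let L := solve n (size Q - size P) (once P) in
  all (fun R => size R == size Q - size P) L && extend_to n P L Q.
Lemma unique_cover_next n P Q : unique_cover n P -> all_size n.+1 Q -> uniq Q ->
  2 * size Q < 3 * (size P).+1 -> next_ok n P Q -> unique_cover n.+1 Q.
Proof.
move=> uP wQ uQ sQ /andP[sL ok]; split=> // S cS sS.
have [|f [X [A [B [If pf cT ABP sX]]]]] := normalize uP cS; first by rewrite sS.
apply: (equiv_map If); apply: equiv_trans (equiv_perm _ pf) _.
by apply: (extend_to_equiv (@solve_complete n _ _) sL ok cT ABP); rewrite sX sS.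
Qed.

(** * Minimum covers in dimensions up to 7 *)

Definition next n k P := flatten [seq extensions n P X | X <- solve n k (once P)].
Definition cover1 : seq word := [:: [::]].
Definition cover2 := Eval vm_compute in head [::] (next 0 1 cover1).
Definition cover3 := Eval vm_compute in head [::] (next 1 1 cover2).
Definition cover5 := Eval vm_compute in head [::] (next 2 2 cover3).
Definition cover8 := Eval vm_compute in head [::] (next 3 3 cover5).
Definition cover12 := Eval vm_compute in head [::] (next 4 4 cover8).
Definition cover18 := Eval vm_compute in head [::] (next 5 6 cover12).

Lemma unique_cover1 : unique_cover 0 cover1.
Proof.
by split=> // S [wS _]; case: S wS => // w S; case: S; case: w => // _ _; apply: equiv_perm.
Qed.
Lemma unique_cover12 : unique_cover 5 cover12.
Proof.
have u2 : unique_cover 1 cover2 by apply: (unique_cover_next unique_cover1); vm_compute.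
have u3 : unique_cover 2 cover3 by apply: (unique_cover_next u2); vm_compute.
have u5 : unique_cover 3 cover5 by apply: (unique_cover_next u3); vm_compute.
have u8 : unique_cover 4 cover8 by apply: (unique_cover_next u5); vm_compute.
by apply: (unique_cover_next u8); vm_compute.
Qed.
Lemma unique_cover18 : unique_cover 6 cover18.
Proof. by apply: (unique_cover_next unique_cover12); vm_compute. Qed.
Lemma all_size_cover18 : all_size 6 cover18. Proof. by vm_compute. Qed.

Fixpoint dedup (L acc : seq (seq word)) :=
  if L is X :: L then
    if has (fun Y => all (mem X) Y && all (mem Y) X) acc then dedup L acc else dedup L (X :: acc)
  else acc.
(** A list of seven words that contains [third6] adds an arbitrary word to it, so that only
    [third6] and the lists that do not contain it are recorded. *)
Definition third6 := Eval vm_compute in head [::] (solve 5 6 (once cover12)).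
Definition glued7 := glue_once 4 4 7 cover12.
Definition thirds12 := Eval vm_compute in
  third6 :: dedup [seq X <- glued7 | ~~ all (mem X) third6] [::].
Lemma thirds12_complete : complete 5 (once cover12) 7 thirds12.
Proof.
by apply: (@complete_refines _ _ _ glued7); [vm_compute|apply: glue_once_complete].
Qed.

(** The words of [cover18] that do not start with La have [cover12] as tails, so gluing
    along La can use [thirds12].  Another letter is first moved to La by a symmetry of
    [cover18]. *)
Lemma others_cover18 : others La cover18 = cover12. Proof. by vm_compute. Qed.
Definition symmetry_to_La b : seq (nat * lperm) :=
  odflt [::] (first_some (fun s => if ap s b == La then omap (cons (0, s))
    (find_isom cover18 [seq [:: ap s (head La w)] | w <- cover18]
       [seq [seq rev (take k.+1 t) | t <- cover18] | k <- iota 1 5] (iota 1 5)) else None) lperms).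
Definition symmetryLb := Eval vm_compute in symmetry_to_La Lb.
Definition symmetryLc := Eval vm_compute in symmetry_to_La Lc.
Definition symmetry18 b : seq (nat * lperm) :=
  match b with La => [seq (i, idp) | i <- iota 0 6] | Lb => symmetryLb | Lc => symmetryLc end.
Definition inverse_lperm (s : lperm) : lperm :=
  nth idp lperms (find (fun r => all (fun l => ap r (ap s l) == l) letters) lperms).
Definition inverse (g : seq (nat * lperm)) : seq (nat * lperm) :=
  [seq let k := index j (map fst g) in (k, inverse_lperm (nth (0, idp) g k).2)
  | j <- iota 0 (size g)].
Definition moves_to_La b (g : seq (nat * lperm)) :=
  if g is (j, s) :: _ then [&& j == 0, s \in lperms & ap s b == La] else false.
Lemma symmetry18_ok b : let g := symmetry18 b in
  [&& moves_to_La b g, valid 6 g, perm_eq (map (act g) cover18) cover18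
    & all (fun w => act (inverse g) (act g w) == w) (words 6)].
Proof. by case: b; vm_compute. Qed.
Lemma size_others_act n b g (X : seq word) : moves_to_La b g -> all_size n.+1 X ->
  size (others La (map (act g) X)) = size (others b X).
Proof.
case: g => // -[j s] g /and3P[/eqP-> sp /eqP sb] /allP wX.
rewrite !size_map !size_filter count_map; apply: eq_in_count => w wX' /=.
by rewrite nth0 -sb (inj_eq (ap_inj sp)).
Qed.

Definition glued11 := Eval vm_compute in glue 5 11 La (once cover18) thirds12.
Lemma glued11E : glue 5 11 La (once cover18) thirds12 = glued11. Proof. by vm_compute. Qed.
Lemma move_to_glued11 (X : seq word) : all_size 6 X -> hits_once 6 cover18 X -> size X <= 11 ->
  exists b (Y : seq word), Y \in glued11 /\ perm_eq (map (act (symmetry18 b)) X) Y.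
Proof.
move=> wX cX sX; have [b sb] := @small_others 11 7 X sX isT.
have /and4P[mb vb Hb _] := symmetry18_ok b; have Ib := act_isom vb.
have cX' : hits_once 6 cover18 (map (act (symmetry18 b)) X).
  apply: (hits_once_perm Hb); first exact: isom_size all_size_cover18.
  by apply: hits_once_isom => //; exact: all_size_cover18.
exists b; rewrite -glued11E; apply: (@glue_complete _ 7) => //.
- by apply: complete_others; [exact: all_size_cover18|rewrite others_cover18; exact: thirds12_complete].
- exact: isom_size.
- by rewrite size_map.
by rewrite (size_others_act mb wX).
Qed.

(** Eleven words are the fewest that can hit the points [cover18] hits once, and the
    symmetries of [cover18] act transitively on these lists. *)
Definition third11 := Eval vm_compute in head [::] glued11.
Lemma glued11_isomorphic : all (fun Y => isomorphic2 6 Y cover18 third11 cover18) glued11.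
Proof. by vm_compute. Qed.
Lemma unique_third11 (X : seq word) : all_size 6 X -> hits_once 6 cover18 X -> size X <= 11 ->
  exists f, [/\ isom 6 f, perm_eq (map f X) third11 & perm_eq (map f cover18) cover18].
Proof.
move=> wX cX sX; have [b [Y [Yin XY]]] := move_to_glued11 wX cX sX.
have /and4P[mb vb Hb _] := symmetry18_ok b.
have [f [If Y11 H18]] := isomorphic2P (allP glued11_isomorphic Y Yin).
exists (f \o act (symmetry18 b)); split; first by apply: isom_comp => //; apply: act_isom.
  by rewrite map_comp (permPl (perm_map f XY)).
by rewrite map_comp (permPl (perm_map f Hb)).
Qed.

Definition unglued11 :=
  flatten [seq [seq map (act (inverse (symmetry18 b))) Y | Y <- glued11] | b <- letters].
Definition thirds18 := Eval vm_compute in dedup unglued11 [::].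
Lemma thirds18_refines : refines unglued11 thirds18. Proof. by vm_compute. Qed.
Lemma thirds18_complete : complete 6 (once cover18) 11 thirds18.
Proof.
apply: complete_refines thirds18_refines _ => X wX sX cX.
have [b [Y [Yin XY]]] := move_to_glued11 wX cX sX.
have /and4P[_ _ _ inv] := symmetry18_ok b.
exists (map (act (inverse (symmetry18 b))) Y), [::]; split.
  apply/flattenP; exists [seq map (act (inverse (symmetry18 b))) Y | Y <- glued11].
    by apply: (map_f (fun b => [seq map (act (inverse (symmetry18 b))) Y | Y <- glued11])); case: (b).
  by move: glued11 Yin => L Yin; exact: map_f.
rewrite cats0 -(permPr (perm_map _ XY)) -map_comp map_id_in // => w /(allP wX) /eqP sw.
by apply/eqP/(allP inv); rewrite mem_words sw.
Qed.

(** A word can be removed from a cover of size 19 to leave a copy of [cover18], unless the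
    cover is one of two others, up to symmetry. *)
Definition removable (S : seq word) :=
  has (fun s => (size s == 6) && empty 6 (remove_all (seq.rem s S) full)) S.
Definition thirds12_7 := [seq w :: third6 | w <- words 5] ++ behead thirds12.
Definition classes19 := Eval vm_compute in
  let L := flatten [seq [seq S <- extensions 5 cover12 R | ~~ removable S] | R <- thirds12_7] in
  foldl (fun acc S => if has (isomorphic 6 S) acc then acc else rcons acc S) [::] L.
Definition cover19a := Eval vm_compute in nth [::] classes19 0.
Definition cover19b := Eval vm_compute in nth [::] classes19 1.
Lemma thirds12_7P (X : seq word) : all_size 5 X -> size X = 7 -> hits_once 5 cover12 X ->
  exists2 R, R \in thirds12_7 & perm_eq X R.
Proof.
move=> wX sX cX; have [|R [Z [RL XRZ]]] := thirds12_complete wX _ cX; first by rewrite sX.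
have sRZ : size R + size Z = 7 by rewrite -size_cat -(perm_size XRZ).
move: RL; rewrite -[thirds12]/(third6 :: behead thirds12) inE => /orP[/eqP eR|RL].
  case: Z XRZ sRZ => [|z [|z' Z]] XRZ; rewrite eR //= => _; exists (z :: third6).
    rewrite mem_cat (map_f (fun w => w :: third6)) // mem_words.
    by apply: (allP wX); rewrite (perm_mem XRZ) mem_cat mem_head orbT.
  by rewrite (permPl XRZ) eR perm_catC.
have s7 : all (fun R => size R == 7) (behead thirds12) by vm_compute.
exists R; first by rewrite mem_cat RL orbT.
move: sRZ; rewrite (eqP (allP s7 R RL)) -[RHS](addn0 7).
by move/addnI; clear RL s7; case: Z XRZ; rewrite ?cats0.
Qed.
Lemma thirds12_7_ok : all (fun R => all (fun S =>
    removable S || has (isomorphic 6 S) [:: cover19a; cover19b]) (extensions 5 cover12 R)) thirds12_7.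
Proof. by vm_compute. Qed.
Lemma covers_of_size19 (S : seq word) : is_cover 6 S -> size S = 19 ->
  exists P, equiv 6 S P /\
    ((exists2 s, size s = 6 & P = s :: cover18) \/ P \in [:: cover19a; cover19b]).
Proof.
move=> cS sS; have [|f [X [A [B [If pf cT ABP sX]]]]] := normalize unique_cover12 cS.
  by rewrite sS.
have [wX _ _ _] := assemble_cover cT.
have [|R RL XR] := thirds12_7P wX _ (third_hits_once cT ABP); first by rewrite sX sS.
have [Q [Qin SQ]] := extension_perm cT ABP XR.
have pSQ : perm_eq (map f S) Q by rewrite (permPl pf).
have wQ := (is_cover_perm SQ cT).1.
have eSQ : equiv 6 S Q by exists f.
have := allP (allP thirds12_7_ok R RL) Q Qin.
case/orP=> [/hasP[s sQ /andP[/eqP ss em]]|/hasP[P Pin /isomorphicP QP]].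
  have wQ' : all_size 6 (seq.rem s Q) by apply/allP => w /mem_rem /(allP wQ).
  have cQ' : is_cover 6 (seq.rem s Q).
    split=> // x sx _; move/emptyP: em => /(_ x sx).
    by rewrite (get_remove_all _ wQ') //= => /negbT; rewrite negbK.
  have sQ' : size (seq.rem s Q) = 18 by rewrite size_rem // -(perm_size pSQ) size_map sS.
  have [_ _ H18] := unique_cover18; have [g [Ig pg]] := H18 _ cQ' sQ'.
  exists (g s :: cover18); split; last by left; exists (g s) => //; apply: Ig.1.
  apply: equiv_trans eSQ _; exists g; split=> //.
  by rewrite (permPl (perm_map g (perm_to_rem sQ))) /= perm_cons.
by exists P; split; [apply: equiv_trans eSQ QP|right].
Qed.

Definition cover29 := Eval vm_compute in head [::] (extensions 6 cover18 third11).
Lemma extend18_ok : all (fun S => isomorphic 7 S cover29) (extensions 6 cover18 third11).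
Proof. by vm_compute. Qed.
Lemma extend18 X A B : is_cover 7 (assemble X A B) -> perm_eq (A ++ B) cover18 ->
  size X <= 11 -> equiv 7 (assemble X A B) cover29.
Proof.
move=> cS AB18 sX; have [wX _ _ _] := assemble_cover cS.
have [f [If pX p18]] := unique_third11 wX (third_hits_once cS AB18) sX.
apply: (equiv_assemble If).
have [|Q [Qin pQ]] := extension_perm (assemble_cover_map If cS) _ pX (P := cover18).
  by rewrite -map_cat (permPl (perm_map f AB18)).
apply: equiv_trans (isomorphicP (allP extend18_ok Q Qin)); exact: equiv_perm.
Qed.
(** If ten words [X] could complete [cover18] with a redundant word [s] added, then [s :: X]
    would hit all that [cover18] hits once, hence be a copy of [third11]. *)
Lemma extend18_plus_ok :
  all (fun s => nilp (extensions 6 (s :: cover18) (seq.rem s third11))) third11.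
Proof. by vm_compute. Qed.
Lemma extend18_plus s X A B : is_cover 7 (assemble X A B) -> size s = 6 ->
  perm_eq (A ++ B) (s :: cover18) -> size X <= 10 -> False.
Proof.
move=> cS ss ABP sX; have [wX _ _ _] := assemble_cover cS.
have wsX : all_size 6 (s :: X) by apply/andP; split; [rewrite ss|].
have wsP : all_size 6 (s :: cover18).
  by apply/andP; split; [rewrite ss|exact: all_size_cover18].
have cX := third_hits_once cS ABP.
have csX : hits_once 6 cover18 (s :: X).
  move=> x sx; rewrite (get_once all_size_cover18) // => /eqP Hx /=.
  case sx' : (hits s x) => //=; apply: cX => //; rewrite (get_once wsP) //.
  by rewrite -[count _ _]/(hits s x + count (hits^~ x) cover18) sx' Hx.
have [f [If pX p18]] := unique_third11 wsX csX sX.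
have s11 : f s \in third11 by rewrite -(perm_mem pX) mem_head.
have pX' : perm_eq (map f X) (seq.rem (f s) third11).
  by rewrite -(perm_cons (f s)) -(permPr (perm_to_rem s11)).
have [|Q [Qin pQ]] := extension_perm (assemble_cover_map If cS) _ pX' (P := f s :: cover18).
  by rewrite -map_cat (permPl (perm_map f ABP)) /= perm_cons.
by have := allP extend18_plus_ok _ s11; case: (extensions _ _ _) Qin.
Qed.
Definition thirds19 P := glue_once 5 6 10 P.
Lemma extend19_ok : all (fun P => [&& all_size 6 P, all (fun R => size R == 10) (thirds19 P)
   & extend_to 6 P (thirds19 P) cover29]) [:: cover19a; cover19b].
Proof. by vm_compute. Qed.
Lemma extend19 P X A B : P \in [:: cover19a; cover19b] -> is_cover 7 (assemble X A B) ->
  perm_eq (A ++ B) P -> size X = 10 -> equiv 7 (assemble X A B) cover29.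
Proof.
move=> Pin cS ABP sX; have /and3P[wP sP eP] := allP extend19_ok P Pin.
by apply: (extend_to_equiv _ sP eP cS ABP sX); apply: glue_once_complete.
Qed.
(** Two slices of a cover of size 29 may have 18 or 19 words, so that covers of size 19 come
    in as well. *)
Lemma unique_cover29 : unique_cover 7 cover29.
Proof.
split; [by vm_compute|by vm_compute|]; move=> S cS sS.
have sS29 : size S = 29 by rewrite sS.
have [f [X [A [B [If pf cT s1 s2]]]]] := normal_form cS.
have [_ cAB _ _] := assemble_cover cT.
have min : 18 <= size (A ++ B) := unique_cover_min unique_cover18 cAB.
apply: (equiv_map If); apply: equiv_trans (equiv_perm _ pf) _.
clear pf sS If; rewrite sS29 in s1 s2.
have [e18|ne18] := eqVneq (size (A ++ B)) 18.
  have [_ _ H18] := unique_cover18; have [g [Ig pg]] := H18 _ cAB e18.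
  apply: (equiv_assemble Ig); apply: extend18; first exact: assemble_cover_map.
    by rewrite -map_cat.
  by rewrite size_map; move: s2; rewrite e18; clear; lia.
have e19 : size (A ++ B) = 19 by move: min s1 ne18; clear; lia.
have sX : size X = 10 by move: s2; rewrite e19; clear; lia.
have [P [[g [Ig pg]] cases]] := covers_of_size19 cAB e19.
have cT' := assemble_cover_map Ig cT; rewrite map_cat in pg.
case: cases => [[s ss eP]|Pin].
  by exfalso; apply: (extend18_plus cT' ss); rewrite -?eP // size_map sX.
by apply: (equiv_assemble Ig); apply: (extend19 Pin cT' pg); rewrite size_map.
Qed.

(** * Dimensions 8 and 9 *)

Lemma all_size_cover29 : all_size 7 cover29. Proof. by vm_compute. Qed.
Lemma heads_cover29 : [/\ size cover29 = 29, count (fun w => head La w == La) cover29 = 11,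
  count (fun w => head La w == Lb) cover29 = 10 & count (fun w => head La w == Lc) cover29 = 8].
Proof. by split; vm_compute. Qed.
Lemma others_cover29 : others La cover29 = cover18. Proof. by vm_compute. Qed.
Definition cover19 := Eval vm_compute in others Lb cover29.
Lemma others_Lb_cover29 : others Lb cover29 = cover19. Proof. by vm_compute. Qed.
Definition thirds19Lb := Eval vm_compute in dedup (thirds19 cover19) [::].
Lemma thirds19Lb_complete : complete 6 (once cover19) 10 thirds19Lb.
Proof.
apply: (@complete_refines _ _ _ (thirds19 cover19)); first by vm_compute.
by apply: glue_once_complete; vm_compute.
Qed.

Definition thirds29 := Eval vm_compute in dedup (glue 6 15 La (once cover29) thirds18) [::].
Lemma thirds29_La : all (fun Y => has (perm_eq Y) thirds29) (glue 6 15 La (once cover29) thirds18).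
Proof. by vm_compute. Qed.
Lemma thirds29_Lb : nilp (glue 6 15 Lb (once cover29) thirds19Lb).
Proof. by vm_compute. Qed.
Definition covers44 := Eval vm_compute in flatten [seq extensions 7 cover29 X | X <- thirds29].
Lemma covers44E : flatten [seq extensions 7 cover29 X | X <- thirds29] = covers44.
Proof. by vm_compute. Qed.

Definition swap2 n : seq (nat * lperm) := [:: (1, idp), (0, idp) & [seq (i, idp) | i <- iota 2 n]].
Lemma swap2_valid n : valid n.+2 (swap2 n).
Proof.
apply/andP; split; last by rewrite /= all_map; apply/allP => i _.
rewrite /swap2 [map _ _]/= -map_comp map_id.
by apply/permP => p /=; lia.
Qed.
Lemma second_letter n P l (S : seq word) : unique_cover n.+1 P -> is_cover n.+2 S ->
  count (fun w => nth La w 1 == l) S + size P <= size S.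
Proof.
move=> uP cS; have cS' := is_cover_isom (act_isom (swap2_valid n)) cS.
have := unique_cover_min uP (is_cover_others l cS').
have := size_others l (map (act (swap2 n)) S); rewrite count_map size_map.
have -> : count (preim (act (swap2 n)) (fun w => head La w == l)) S = count (fun w => nth La w 1 == l) S.
  by apply: eq_count => w /=; case: (nth La w 1).
by lia.
Qed.
(** The third slice [X] of a cover of size 44 is out of reach of a direct search.  But at
    least 29 words of that cover avoid any given second letter, so that each second letter
    occurs at most 15 times in it, and 11, 10 or 8 of these times in [cover29].  As [X] has
    15 words, La occurs 4 times or Lb occurs 5 times as first letter in [X], and the known
    lists for a slice can be glued. *)
Lemma thirds29P (X : seq word) : all_size 7 X -> size X = 15 -> hits_once 7 cover29 X ->
  (forall l, count (fun w => head La w == l) X + count (fun w => head La w == l) cover29 <= 15) ->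
  exists2 Y, Y \in thirds29 & perm_eq X Y.
Proof.
move=> wX sX cX H; have [s29 ha hb hc] := heads_cover29.
have hX := sum_heads X; have := H La; have := H Lb; have := H Lc.
rewrite ha hb hc => hc' hb' ha'.
have oa := size_others La X; have ob := size_others Lb X.
have sX15 : size X <= 15 by rewrite sX.
case: (leqP (size (others La X)) 11) => [sa|sa].
  have cL : complete 6 (child La (once cover29)) 11 thirds18.
    apply: complete_others; first exact: all_size_cover29.
    by rewrite others_cover29; exact: thirds18_complete.
  have [Y [Yin XY]] := glue_complete cL wX sX15 sa cX.
  have /hasP[Z Zin YZ] := allP thirds29_La Y Yin.
  by exists Z; [exact: Zin|rewrite (permPl XY)].
have sb : size (others Lb X) <= 10 by move: sX hX ha' hb' hc' oa ob sa; clear; lia.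
have cL : complete 6 (child Lb (once cover29)) 10 thirds19Lb.
  apply: complete_others; first exact: all_size_cover29.
  by rewrite others_Lb_cover29; exact: thirds19Lb_complete.
have [Y [Yin XY]] := glue_complete cL wX sX15 sb cX.
by have := thirds29_Lb; rewrite /nilp; case: (glue _ _ _ _ _) Yin.
Qed.
Lemma covers_of_size44 (S : seq word) : is_cover 8 S -> size S = 44 ->
  exists2 Q, Q \in covers44 & equiv 8 S Q.
Proof.
move=> cS sS; have [s29 _ _ _] := heads_cover29.
have [|f [X [A [B [If pf cT ABP sX]]]]] := normalize unique_cover29 cS.
  by rewrite sS s29.
have [wX _ _ _] := assemble_cover cT.
have [|l|Y Yin XY] := thirds29P wX _ (third_hits_once cT ABP).
- by rewrite sX sS s29.
- have := second_letter l unique_cover29 cT.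
  have <- : size (map f S) = size (assemble X A B) by apply: perm_size.
  rewrite size_map sS s29 /assemble !count_cat !count_map.
  rewrite -(permP ABP) count_cat /preim /=.
  have E (Y : seq word) : count (fun w => nth La w 0 == l) Y = count (fun w => head La w == l) Y.
    by apply: eq_count => w; rewrite nth0.
  by rewrite !E; clear; lia.
have [Q [Qin pQ]] := extension_perm cT ABP XY.
exists Q; last by exists f; split; [exact: If|rewrite (permPl pf); exact: pQ].
rewrite -covers44E; apply/flattenP; exists (extensions 7 cover29 Y); last exact: Qin.
exact: map_f.
Qed.

Fixpoint excess v n (t : tree N) : N :=
  if n is n.+1 then
    N.add (excess v n (child La t)) (N.add (excess v n (child Lb t)) (excess v n (child Lc t)))
  else N.sub (get t [::]) v.
Lemma excessE v n t :
  N.to_nat (excess v n t) = \sum_(w <- words n) (N.to_nat (get t w) - N.to_nat v).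
Proof.
elim: n t => [|n IH] t /=; first by rewrite big_seq1 Nnat.N2Nat.inj_sub.
rewrite !big_cat !big_map /= !Nnat.N2Nat.inj_add !IH.
by congr (_ + (_ + _)); apply: eq_bigr => w _; rewrite get_child.
Qed.
(** Each of [k] words hits at most [v] points, apart from what the heaviest words have in
    excess of [v], which is counted once for the whole list. *)
Lemma npoints_le_excess n t k v (X : seq word) : all_size n X -> size X <= k -> hits_all n t X ->
  N.to_nat (npoints n t) <= k * N.to_nat v + N.to_nat (excess v n (weights n t)).
Proof.
move=> wX sX tX; rewrite npointsE.
have wuX : all_size n (undup X) by apply/allP => w; rewrite mem_undup => /(allP wX).
have tuX : hits_all n t (undup X).
  move=> x sx tx; have /hasP[s sin hs] := tX x sx tx.
  by apply/hasP; exists s; rewrite ?mem_undup.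
apply: leq_trans (count_le_sum_hit tuX) _; rewrite excessE.
set m := N.to_nat v.
apply: (@leq_trans (\sum_(s <- undup X) (m + (num_hit n t s - m)))).
  by apply: leq_sum => s _; lia.
rewrite big_split /= leq_add //.
  apply: leq_trans (sum_le_const (m := m) _) _ => //.
  by rewrite leq_mul2r (leq_trans (size_undup _) sX) orbT.
have sub_words : {subset undup X <= words n} by move=> w /(allP wuX); rewrite mem_words.
have [Z wXZ] := perm_sub (undup_uniq X) sub_words.
rewrite (perm_big _ wXZ) big_cat /= -[X in X <= _]addn0 leq_add //.
rewrite !big_seq; apply: eq_leq; apply: eq_bigr => w /(allP wuX) /eqP sw.
by rewrite weightsE.
Qed.
(** 145 is a bound that few words exceed on the points that a cover of the list hits once. *)
Lemma covers44_ok : all (fun Q => N.ltb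
    (N.add (N.mul 22 145) (excess 145 8 (weights 8 (once Q)))) (npoints 8 (once Q))) covers44.
Proof. by vm_compute. Qed.
Lemma no_third44 Q (X : seq word) : Q \in covers44 -> all_size 8 X -> size X <= 22 ->
  hits_once 8 Q X -> False.
Proof.
move=> /(allP covers44_ok); rewrite N_ltbE Nnat.N2Nat.inj_add Nnat.N2Nat.inj_mul => + wX sX cX.
by rewrite ltnNge => /negP; apply; have := npoints_le_excess 145 wX sX cX.
Qed.

Lemma size_cover_dim8 (S : seq word) : is_cover 8 S -> 44 <= size S.
Proof.
move=> cS; have [s29 _ _ _] := heads_cover29.
have H b : 29 <= size (others b S).
  by rewrite -s29; apply: unique_cover_min unique_cover29 (is_cover_others b cS).
have := H La; have := H Lb; have := H Lc; have := sum_heads S.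
have := size_others La S; have := size_others Lb S; have := size_others Lc S; clear; lia.
Qed.
Lemma size_cover_dim9 (S : seq word) : is_cover 9 S -> 67 <= size S.
Proof.
move=> cS; rewrite leqNgt; apply/negP => lt67.
have [f [X [A [B [_ _ cT s1 s2]]]]] := normal_form cS.
have [_ cAB _ _] := assemble_cover cT; have min := size_cover_dim8 cAB.
have e44 : size (A ++ B) = 44 by move: min s1 lt67; clear; lia.
have sX : size X <= 22 by move: s2 lt67; rewrite e44; clear; lia.
have [Q Qin [g [Ig pg]]] := covers_of_size44 cAB e44.
have cT' := assemble_cover_map Ig cT; have [wX' _ _ _] := assemble_cover cT'.
rewrite map_cat in pg; apply: (no_third44 Qin wX' _ (third_hits_once cT' pg)).
by rewrite size_map.
Qed.

Import Order.TTheory GRing.Theory Num.Theory.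
Local Open Scope ring_scope.

(** * Small covers from the lights out lemma *)

Lemma F2P (a : 'F_2) : a = 0 \/ a = 1.
Proof. by case: a => -[|[|[]]] // p; [left|right]; apply/val_inj. Qed.
Lemma F2_idem (a : 'F_2) : a * a = a.
Proof. by case: (F2P a) => ->; rewrite ?mulr0 ?mulr1. Qed.
Lemma F2_double (a : 'F_2) : a + a = 0.
Proof. by case: (F2P a) => ->; apply/val_inj. Qed.

Lemma sum_symmetric n (f : 'I_n -> 'I_n -> 'F_2) : (forall i j, f i j = f j i) ->
  \sum_i \sum_j f i j = \sum_i f i i.
Proof.
move=> fC.
have E (i : 'I_n) : \sum_j f i j = f i i + (\sum_(j < n | (j < i)%N) f i j + \sum_(j < n | (i < j)%N) f i j).
  rewrite (bigD1 i) //=; congr (_ + _).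
  rewrite (bigID (fun j : 'I_n => (j < i)%N)) /=; congr (_ + _); apply: eq_bigl => j.
    by rewrite -val_eqE /=; lia.
  by rewrite -val_eqE /=; lia.
rewrite (eq_bigr _ (fun i _ => E i)) big_split /= big_split /=.
rewrite [X in _ + (_ + X)](exchange_big_dep xpredT) //=.
rewrite -big_split /= [X in _ + X]big1 ?addr0 // => i _.
rewrite [X in _ + X](eq_bigr (fun j => f i j)); last by move=> j _; apply: fC.
exact: F2_double.
Qed.

(** Over F_2 the quadratic form of a symmetric matrix is linear, with the diagonal as
    coefficients: the other terms cancel in pairs and squares are idempotent.  So the diagonal
    is orthogonal to the kernel of [M], hence lies in its row space. *)
Lemma lights_out n (M : 'M['F_2]_n) : M^T = M -> exists v : 'rV_n, v *m M = \row_i M i i.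
Proof.
move=> MT; suff /submxP[v ->] : (\row_i M i i <= M)%MS by exists v.
rewrite submxE; move: (cokermx M) (mulmx_coker M) => C MC.
apply/eqP/rowP => j; rewrite !mxE.
transitivity ((C^T *m (M *m C)) j j); last by rewrite MC mulmx0 mxE.
rewrite [RHS]mxE [RHS](eq_bigr (fun i => \sum_k C i j * M i k * C k j)); last first.
  by move=> i _; rewrite !mxE big_distrr /=; apply: eq_bigr => k _; rewrite mulrA.
rewrite sum_symmetric => [|i k]; last first.
  by have -> : M k i = M i k; [rewrite -[in LHS]MT mxE|ring].
by apply: eq_bigr => i _; rewrite mxE mulrAC F2_idem mulrC.
Qed.

(** For the adjacency matrix [A] of a graph, the vertex sets that induce a subgraph with all
    degrees even; sets are encoded by their indicator vectors. *)
Definition eulerian n (A : 'M['F_2]_n) : {set 'rV['F_2]_n} :=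
  [set u : 'rV['F_2]_n | [forall i, u 0 i * (u *m A) 0 i == 0]].

(** The letter is 0 inside the set, and elsewhere 1 or 2 according to whether the vertex has an
    even or an odd number of neighbours in the set. *)
Definition word_of n (A : 'M['F_2]_n) (u : 'rV['F_2]_n) : 'rV['Z_3]_n :=
  \row_i if u 0 i != 0 then 0 else if (u *m A) 0 i == 0 then 1 else 1 + 1.

(** Restrict the graph to the vertices where [x] is not 0 and put loops where it is 1.  Lights
    out gives a vertex set whose neighbourhood counts have the parity of the loops; its part
    in the support of [x] is the set wanted. *)
Lemma word_of_avoids n (A : 'M['F_2]_n) (x : 'rV['Z_3]_n) : A^T = A -> (forall i, A i i = 0) ->
  exists2 u, u \in eulerian A & forall i, word_of A u 0 i != x 0 i.
Proof.
move=> AT A0; pose m i : 'F_2 := if x 0 i == 0 then 0 else 1.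
pose t i : 'F_2 := if x 0 i == 1 then 1 else 0.
pose M : 'M['F_2]_n := \matrix_(i, j) (m i * m j * A i j + (t i *+ (i == j))).
have MT : M^T = M.
  apply/matrixP => i j; rewrite !mxE [m j * _]mulrC -[in LHS]AT mxE eq_sym.
  by case: eqP => [->|].
have [v vM] := lights_out MT.
pose u : 'rV['F_2]_n := \row_i (v 0 i * m i).
have E j : m j * (u *m A) 0 j + v 0 j * t j = t j.
  have e : \sum_i v 0 i * M i j = t j.
    by have := congr1 (fun r : 'rV_n => r 0 j) vM; rewrite !mxE A0 mulr0 add0r eqxx mulr1n.
  rewrite -[RHS]e; under [in RHS]eq_bigr do rewrite mxE mulrDr.
  rewrite big_split /=; congr (_ + _).
    by rewrite mxE big_distrr /=; apply: eq_bigr => i _; rewrite mxE; ring.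
  by rewrite (bigD1 j) //= ?eqxx ?mulr1n big1 ?addr0 // => i /negbTE->; rewrite mulr0n mulr0.
have key i : (u 0 i * (u *m A) 0 i == 0) && (word_of A u 0 i != x 0 i).
  have := E i; rewrite [word_of _ _ _ _]mxE; have : u 0 i = v 0 i * m i by rewrite mxE.
  rewrite /m /t; set c := (u *m A) 0 i; set a := u 0 i.
  case: (x 0 i) => -[|[|[|//]]] p /=; case: (F2P (v 0 i)) => ->; case: (F2P c) => -> ->;
    by rewrite ?mulr0 ?mulr1 ?mul0r ?mul1r ?add0r ?addr0 //= => /eqP.
exists u; last by move=> i; have /andP[] := key i.
by rewrite inE; apply/forallP => i; have /andP[] := key i.
Qed.

(** The sets that remain eulerian when a new vertex with neighbourhood [N] joins them, apart
    from the condition at the new vertex. *)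
Definition admissible n (A : 'M['F_2]_n) (N : 'rV['F_2]_n) : {set 'rV['F_2]_n} :=
  [set u : 'rV['F_2]_n | [forall i, u 0 i * N 0 i == u 0 i * (u *m A) 0 i]].

(** [N] is determined on an admissible set and free outside, so that a pair of a set and a
    neighbourhood amounts to a word in three letters. *)
Lemma sum_admissible n (A : 'M['F_2]_n) : (\sum_(N : 'rV['F_2]_n) #|admissible A N| <= 3 ^ n)%N.
Proof.
rewrite (eq_bigr (fun N : 'rV['F_2]_n => \sum_(u : 'rV['F_2]_n | u \in admissible A N) 1)%N); last first.
  by move=> N _; rewrite sum1_card.
rewrite pair_big_dep /= sum1_card.
pose code (p : 'rV['F_2]_n * 'rV['F_2]_n) : 'rV['I_3]_n :=
  \row_i if p.2 0 i != 0 then inord 2 else if p.1 0 i == 0 then inord 0 else inord 1.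
have inj : {in [pred p : 'rV['F_2]_n * 'rV['F_2]_n | p.2 \in admissible A p.1] &, injective code}.
  move=> [N u] [N' u']; rewrite !inE /= => /forallP Nu /forallP Nu' /rowP e.
  have eu : u = u'.
    apply/rowP => i; have := e i; rewrite !mxE /= => /(congr1 val) /=.
    by case: (F2P (u 0 i)) => ->; case: (F2P (u' 0 i)) => -> //=; case: eqP => _; rewrite !inordK.
  rewrite -eu in e Nu' *; congr pair; apply/rowP => i.
  have := e i; rewrite !mxE /= => /(congr1 val) /=; have := Nu i; have := Nu' i.
  case: (F2P (u 0 i)) => ->; rewrite ?mul1r /= => /eqP e1 /eqP e2; first last.
    by rewrite e1 e2.
  by case: (F2P (N 0 i)) => ->; case: (F2P (N' 0 i)) => -> //=; rewrite !inordK.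
have := max_card (mem (codom code)); rewrite card_mx card_ord mul1n.
apply: leq_trans.
rewrite -(card_in_image inj); apply: subset_leq_card; apply/subsetP => y /imageP[p _ ->].
exact: codom_f.
Qed.

Lemma exists_below_average (T : finType) (f : T -> nat) m : (0 < #|T|)%N ->
  (\sum_x f x <= m)%N -> exists x, (f x * #|T| <= m)%N.
Proof.
move=> T0 fm; case: (pickP (fun x => f x * #|T| <= m)%N) => [x|H]; first by exists x.
suff : (#|T| * m.+1 <= #|T| * \sum_x f x)%N by rewrite leq_pmul2l // ltnNge fm.
rewrite big_distrr /= -sum_nat_const; apply: leq_sum => x _.
by rewrite mulnC ltnNge H.
Qed.

(** Vertices are added one at a time, each with a neighbourhood for which the number of new
    eulerian sets is at most the average (3/2)^n. *)
Lemma few_eulerian n : exists A : 'M['F_2]_n, [/\ A^T = A, forall i, A i i = 0 &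
  (#|eulerian A| * 2 ^ n + 2 ^ n <= 2 * 3 ^ n)%N].
Proof.
elim: n => [|n [A [AT A0 cA]]].
  exists 0; split; rewrite ?trmx0 //; first by move=> i; rewrite mxE.
  have : (#|eulerian (0 : 'M['F_2]_0)| <= 1)%N.
    by apply: leq_trans (max_card _) _; rewrite card_mx muln0.
  by rewrite !expn0 !muln1; lia.
have [N cN] : exists N : 'rV['F_2]_n, (#|admissible A N| * 2 ^ n <= 3 ^ n)%N.
  have c : #|{: 'rV['F_2]_n}| = (2 ^ n)%N by rewrite card_mx card_Fp // mul1n.
  by have [|N] := exists_below_average _ (sum_admissible A); rewrite c ?expn_gt0 //; exists N.
pose A' : 'M['F_2]_(1 + n) := block_mx 0 N N^T A.
have AT' : A'^T = A' by rewrite tr_block_mx trmx0 trmxK AT.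
have A0' i : A' i i = 0.
  by case: (split_ordP i) => j ->; rewrite ?block_mxEul ?block_mxEdr ?A0 // mxE.
exists A'; split=> //.
have : (#|eulerian A'| <= #|eulerian A| + #|admissible A N|)%N.
  have sub : eulerian A' \subset [set row_mx 0 u | u : 'rV['F_2]_n in eulerian A]
      :|: [set row_mx 1 u | u : 'rV['F_2]_n in admissible A N].
    apply/subsetP => w; rewrite -[w]hsubmxK; move: (lsubmx w) (rsubmx w) => b u.
    have -> : b = (b 0 0)%:M by rewrite [LHS]mx11_scalar.
    move: (b 0 0) => a; rewrite [in X in X -> _]inE => /forallP E.
    have {}E i : u 0 i * (a * N 0 i + (u *m A) 0 i) = 0.
      have := E (rshift 1 i); rewrite mul_row_block row_mxEr row_mxEr mxE mul_scalar_mx.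
      by rewrite [(a *: N) _ _]mxE => /eqP.
    apply/setUP; case: (F2P a) E => -> E; [left|right].
      apply/imsetP; exists u; last by congr row_mx; apply/matrixP => i j; rewrite !mxE mul0rn.
      by rewrite inE; apply/forallP => i; have := E i; rewrite mul0r add0r => ->.
    apply/imsetP; exists u => //; rewrite inE; apply/forallP => i.
    have := E i; rewrite mul1r mulrDr => /eqP; rewrite addr_eq0 => /eqP->.
    by apply/eqP; case: (F2P (u 0 i * (u *m A) 0 i)) => ->; apply/val_inj.
  apply: leq_trans (subset_leq_card sub) _.
  by apply: leq_trans (leq_card_setU _ _) _; apply: leq_add; apply: leq_imset_card.
move=> h; rewrite !expnS.
have fin e e' m x y : (e * x + x <= 2 * y -> m * x <= y -> e' <= e + m ->
    e' * (2 * x) + 2 * x <= 2 * (3 * y))%N.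
  by move=> h1 h2 h3; have := leq_mul h3 (leqnn x); nia.
exact: fin cA cN h.
Qed.

Definition avoiding n (W : {set 'rV['Z_3]_n}) := forall x : 'rV['Z_3]_n,
  exists2 w, w \in W & forall i, w 0 i != x 0 i.
Lemma few_words n : exists2 W : {set 'rV['Z_3]_n}, avoiding W & (#|W| * 2 ^ n <= 2 * 3 ^ n)%N.
Proof.
have [A [AT A0 cA]] := few_eulerian n.
exists [set word_of A u | u in eulerian A].
  move=> x; have [u uE ux] := word_of_avoids x AT A0.
  by exists (word_of A u) => //; apply: imset_f.
apply: leq_trans cA; apply: (leq_trans _ (leq_addr _ _)).
by rewrite leq_mul2r leq_imset_card orbT.
Qed.

(** * The torus *)

(** The cube with corner [s] contains [x]. *)
Definition reaches n q (s x : 'rV['Z_q]_n) := [forall i, ((x - s)%R ord0 i < 2)%N].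
Lemma coversE n q (S : {set 'rV['Z_q]_n}) :
  covers 2 S = [forall x, exists s in S, reaches s x].
Proof.
apply/eqP/forallP => [e x|H].
  have : x \in [set: 'rV['Z_q]_n] by rewrite inE.
  rewrite -e => /bigcupP[s sS /imsetP[y yc ->]]; apply/existsP; exists s.
  by rewrite sS /reaches addrC addKr; move: yc; rewrite inE.
apply/setP => x; rewrite inE; apply/bigcupP.
have /existsP[s /andP[sS sx]] := H x; exists s => //.
by apply/imsetP; exists (x - s); rewrite ?inE // addrC subrK.
Qed.
Lemma coversP n q (S : {set 'rV['Z_q]_n}) :
  reflect (forall x, exists2 s, s \in S & reaches s x) (covers 2 S).
Proof.
rewrite coversE; apply: (iffP forallP) => H x; first by have /exists_inP := H x.
by apply/exists_inP.
Qed.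
Lemma reaches_refl n q (s : 'rV['Z_q]_n) : reaches s s.
Proof. by apply/forallP => i; rewrite subrr mxE. Qed.
Lemma covers_setT n q : covers 2 [set: 'rV['Z_q]_n].
Proof. by apply/coversP => x; exists x; rewrite ?inE ?reaches_refl. Qed.
Lemma T_le n q (S : {set 'rV['Z_q]_n}) : covers 2 S -> (T n q 2 <= #|S|)%N.
Proof. by rewrite /T; case: arg_minnP => [|S0 _ min]; [exact: covers_setT|exact: min]. Qed.
Lemma T_attained n q : exists2 S : {set 'rV['Z_q]_n}, covers 2 S & #|S| = T n q 2.
Proof. by rewrite /T; case: arg_minnP => [|S0 cS0 _]; [exact: covers_setT|exists S0]. Qed.

Lemma lt2E q (a : 'Z_q) : (1 < q)%N -> (a < 2)%N = (a == 0) || (a == 1).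
Proof.
move=> q1; rewrite -!val_eqE /= modn_small; first by lia.
by rewrite Zp_cast //.
Qed.

Lemma card_lt2 q : (1 < q)%N -> (\sum_(c : 'Z_q) (c < 2))%N = 2%N.
Proof.
move=> q1; transitivity #|[set (0 : 'Z_q); 1]|; last by rewrite cards2 eq_sym oner_eq0.
rewrite -sum1_card [RHS]big_mkcond /=; apply: eq_bigr => c _.
by rewrite lt2E // !inE; case: (_ || _).
Qed.

(** Over each value of the first coordinate, the cubes that meet this slab cover it, and each
    cube meets two slabs. *)
Lemma T_slab n q : (1 < q)%N -> (q * T n q 2 <= 2 * T n.+1 q 2)%N.
Proof.
move=> q1; have [S cS <-] := T_attained n.+1 q.
pose slab (c : 'Z_q) := [set \row_j s ord0 (lift ord0 j) | s : 'rV['Z_q]_n.+1 in S & ((c - s ord0 ord0)%R < 2)%N].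
have cslab c : covers 2 (slab c).
  apply/coversP => x; pose y : 'rV['Z_q]_n.+1 := \row_i oapp (fun j => x ord0 j) c (unlift ord0 i).
  have [s sS /forallP sy] := coversP _ cS y.
  exists (\row_j s ord0 (lift ord0 j)).
    apply: imset_f; rewrite inE sS; have := sy ord0.
    by rewrite mxE [y _ _]mxE unlift_none mxE.
  apply/forallP => j; have := sy (lift ord0 j).
  by rewrite mxE [y _ _]mxE liftK /= !mxE.
have : (\sum_(c : 'Z_q) #|slab c| <= \sum_(c : 'Z_q) \sum_(s in S) ((c - s ord0 ord0)%R < 2)%N)%N.
  apply: leq_sum => c _; apply: leq_trans (leq_imset_card _ _) _.
  rewrite -sum1_card big_mkcond [X in (_ <= X)%N]big_mkcond /=; apply: leq_sum => s _.
  by rewrite inE; case: (s \in S).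
rewrite exchange_big [X in (_ <= X)%N](eq_bigr (fun=> 2%N)); last first.
  move=> s _; rewrite (reindex (fun c => c + s ord0 ord0)); last first.
    by exists (fun c => c - s ord0 ord0) => c _; rewrite ?addrK ?subrK.
  by rewrite -[RHS](card_lt2 q1); apply: eq_bigr => c _; rewrite addrK.
rewrite sum_nat_const => H; rewrite [(2 * _)%N]mulnC; apply: leq_trans H.
have cardq : #|{: 'Z_q}| = q by rewrite card_ord Zp_cast.
rewrite -[X in (X * _ <= _)%N]cardq -sum_nat_const.
by apply: leq_sum => c _; apply: T_le.
Qed.

(** Residues are coloured 0 and 1 alternately; for odd [q] the last one gets colour 2, so
    that consecutive residues have different colours. *)
Definition tint q (t : 'Z_q) : 'Z_3 := if odd q && (t == q.-1 :> nat) then 2 else (odd t)%:R.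
Lemma tint_step q (t : 'Z_q) : (1 < q)%N -> tint (t + 1) != tint t.
Proof.
move=> q1; rewrite /tint.
have tq : (t < q)%N by have := ltn_ord t; rewrite [X in (_ < X)%N]Zp_cast.
have step v : (v < q)%N ->
    ((v + 1 %% (Zp_trunc q).+2) %% (Zp_trunc q).+2 = if v.+1 == q then 0 else v.+1)%N.
  move=> vq; rewrite Zp_cast // (modn_small q1) addn1.
  by case: eqP => [->|ne]; [rewrite modnn|rewrite modn_small //; lia].
have -> : (t + 1)%R = (if t.+1 == q then 0 else t.+1)%N :> nat by apply: step.
case: (t.+1 =P q) => [e|ne].
  have -> : (t == q.-1 :> nat) by lia.
  have -> : (0 == q.-1)%N = false by lia.
  by case oq: (odd q) => //=; rewrite (_ : odd t = true) //; lia.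
have -> : (t == q.-1 :> nat) = false by lia.
rewrite andbF /=; case: ifP => // _; first by case: (odd t).
by case: (odd t).
Qed.
Lemma two_letters (a b w : 'Z_3) : a != b -> w != - (a + b) -> (w == a) || (w == b).
Proof. by case: a => -[|[|[|//]]] ?; case: b => -[|[|[|//]]] ?; case: w => -[|[|[|//]]] ?. Qed.

(** The corners of cubes containing [x] have two colours at each coordinate, hence show every
    word that avoids a third letter: the points with colours in [W] are corners of a cover.
    Colours may be shifted at each coordinate; on average over the shifts, the number of
    corners is (q/3)^n times the number of words. *)
Lemma T_upper n q : (1 < q)%N -> (T n q 2 * 2 ^ n <= 2 * q ^ n)%N.
Proof.
move=> q1; have [W avW cW] := few_words n.
pose S (sg : 'rV['Z_3]_n) := [set t : 'rV['Z_q]_n | (map_mx (@tint q) t + sg) \in W].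
have cS sg : covers 2 (S sg).
  apply/coversP => x.
  pose z : 'rV['Z_3]_n := \row_i - ((tint (x ord0 i) + sg ord0 i) + (tint (x ord0 i - 1) + sg ord0 i)).
  have [w wW wz] := avW z.
  pose s : 'rV['Z_q]_n := \row_i if w ord0 i == tint (x ord0 i) + sg ord0 i then x ord0 i else x ord0 i - 1.
  have ws : map_mx (@tint q) s + sg = w.
    apply/rowP => i; rewrite !mxE; case: eqP => [->//|ne].
    have ab : tint (x ord0 i) + sg ord0 i != tint (x ord0 i - 1) + sg ord0 i.
      by rewrite (inj_eq (addIr _)) -{1}[x ord0 i](subrK 1) tint_step.
    by have := wz i; rewrite [z _ _]mxE => /(two_letters ab) /orP[/eqP/ne|/eqP->].
  exists s; first by rewrite inE ws.
  apply/forallP => i; rewrite lt2E // !mxE; case: (w ord0 i =P _) => _; first by rewrite subrr eqxx.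
  by rewrite opprB addrC subrK eqxx orbT.
have total : (\sum_sg #|S sg| <= q ^ n * #|W|)%N.
  rewrite (eq_bigr (fun sg => \sum_(t : 'rV['Z_q]_n) ((map_mx (@tint q) t + sg)%R \in W)))%N; last first.
    move=> sg _; rewrite -sum1_card big_mkcond /=; apply: eq_bigr => t _.
    by rewrite inE; case: (_ \in W).
  rewrite exchange_big (eq_bigr (fun=> #|W|)) ?sum_nat_const ?card_mx ?card_ord ?Zp_cast ?mul1n //.
  move=> t _; rewrite (reindex (fun w => w - map_mx (@tint q) t)); last first.
    by exists (fun w => w + map_mx (@tint q) t) => w _; rewrite ?addrK ?subrK.
  rewrite -sum1_card [RHS]big_mkcond; apply: eq_bigr => w _.
  by rewrite addrC subrK; case: (w \in W).
have [|sg csg] := exists_below_average _ total; first by rewrite card_mx card_ord expn_gt0.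
have := T_le (cS sg); move: csg cW; rewrite card_mx card_ord mul1n.
have : (0 < 3 ^ n)%N by rewrite expn_gt0.
rewrite -[(Zp_trunc 3).+2]/3%N.
move: (3 ^ n)%N (2 ^ n)%N (q ^ n)%N #|W| #|S sg| (T n q 2) => x y z a b c x0 h1 h2 h3.
rewrite -(leq_pmul2r x0).
have := leq_mul (leq_mul h3 (leqnn x)) (leqnn y); have := leq_mul (leqnn z) h2.
have := leq_mul h1 (leqnn y); nia.
Qed.

(** * Covers of the torus for q = 3 as covers by words *)

Definition letter_of (a : 'Z_3) : letter := match val a with 0%N => La | 1%N => Lb | _ => Lc end.
Definition of_letter (l : letter) : 'Z_3 := match l with La => 0 | Lb => 1 | Lc => 1 + 1 end.
Lemma letter_ofK l : letter_of (of_letter l) = l. Proof. by case: l. Qed.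
Definition to_word n (y : 'rV['Z_3]_n) : seq letter := [seq letter_of (y ord0 i) | i <- enum 'I_n].
Lemma size_to_word n (y : 'rV['Z_3]_n) : size (to_word y) = n.
Proof. by rewrite size_map size_enum_ord. Qed.
Lemma letter_far (a s : 'Z_3) : ((a - s)%R < 2)%N -> letter_of (s + 1 + 1) != letter_of a.
Proof. by case: a => -[|[|[|//]]] ?; case: s => -[|[|[|//]]] ?. Qed.
(** In Z/3Z, [x - s] is 0 or 1 exactly when [x] differs from [s + 2]. *)
Lemma to_word_hits n (s : 'rV['Z_3]_n) (x : seq letter) : size x = n ->
  reaches s (\row_i of_letter (nth La x i)) -> hits (to_word (s + const_mx (1 + 1))) x.
Proof.
move=> sx /forallP H; rewrite hitsE size_to_word ?sx //; apply/allP => i.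
rewrite mem_iota /= add0n => ltin; have := H (Ordinal ltin).
rewrite !mxE => /letter_far; rewrite letter_ofK /to_word (nth_map (Ordinal ltin)) ?size_enum_ord //.
by rewrite (nth_ord_enum (Ordinal ltin) (Ordinal ltin)) !mxE addrA.
Qed.
Lemma T9_ge : (67 <= T 9 3 2)%N.
Proof.
have [S cS <-] := T_attained 9 3.
rewrite cardE -(size_map (fun s : 'rV['Z_3]_9 => to_word (s + const_mx (1 + 1)))).
apply: size_cover_dim9; split=> [|x sx _].
  by apply/allP => w /mapP[s _ ->]; rewrite size_to_word.
have [s sS sx'] := coversP _ cS (\row_i of_letter (nth La x i)).
by rewrite has_map; apply/hasP; exists s; rewrite ?mem_enum //=; apply: to_word_hits.
Qed.
Lemma T10_ge : (101 <= T 10 3 2)%N.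
Proof. by have := T_slab 9 (isT : 1 < 3)%N; have := T9_ge; lia. Qed.

From mathcomp Require Import all_classical all_reals all_analysis.
Import numFieldNormedType.Exports.
Local Open Scope classical_set_scope.
Local Open Scope ring_scope.

(** * The limit *)

Definition density (R : realType) q n : R := (T n q 2)%:R / (q%:R / 2) ^+ n.
Lemma half_gt0 (R : realType) q : (1 < q)%N -> 0 < q%:R / 2 :> R.
Proof. by move=> q1; rewrite divr_gt0 // ltr0n; lia. Qed.
Lemma T_density (R : realType) q n : (1 < q)%N ->
  (T n q 2)%:R = density R q n * (q%:R / 2) ^+ n.
Proof. by move=> q1; rewrite /density divfK // gt_eqF // exprn_gt0 // half_gt0. Qed.
Lemma density_nondecreasing (R : realType) q : (1 < q)%N -> nondecreasing_seq (density R q).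
Proof.
move=> q1; apply/nondecreasing_seqP => n; have h0 := half_gt0 R q1.
have E (x y : R) : 0 < x -> y / x ^+ n.+1 = (y / x) / x ^+ n.
  by move=> x0; rewrite exprS invfM mulrA.
rewrite /density E // ler_pM2r ?invr_gt0 ?exprn_gt0 //.
rewrite ler_pdivlMr // mulrA ler_pdivrMr // mulrC [X in _ <= X]mulrC -!natrM ler_nat.
exact: T_slab.
Qed.
Lemma density_le2 (R : realType) q n : (1 < q)%N -> density R q n <= 2.
Proof.
move=> q1; rewrite /density ler_pdivrMr ?exprn_gt0 ?half_gt0 //.
have := T_upper n q1; rewrite -(ler_nat R) !natrM !natrX.
by rewrite expr_div_n mulrA ler_pdivlMr ?exprn_gt0.
Qed.
Lemma density0 (R : realType) q : (1 < q)%N -> 1 <= density R q 0.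
Proof.
move=> q1; rewrite /density expr0 divr1 -[1]/(1%:R) ler_nat.
have [S /coversP cS <-] := T_attained 0 q.
have [s sS _] := cS 0; by apply/card_gt0P; exists s.
Qed.
(** 101 (2/3)^10 is about 1.7515. *)
Lemma density10 (R : realType) : 7 / 4 <= density R 3 10.
Proof.
rewrite /density ler_pdivlMr ?exprn_gt0 ?half_gt0 //.
apply: le_trans (_ : 101%:R <= _); last by rewrite ler_nat T10_ge.
by lra.
Qed.

Theorem theorem1p1 (R : realType) (q : nat) (hq : (3 <= q)%N) :
  exists Lambda : R,
    [/\ 1 <= Lambda <= 2,
        exists o1 : nat -> R,
          o1 n @[n --> \oo] --> (0 : R) /\
          forall n : nat,
            (T n q 2)%:R = (Lambda + o1 n) * (q%:R / 2) ^+ n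
      & q = 3%N -> 7 / 4 <= Lambda <= 2].
Proof.
have q1 : (1 < q)%N by lia.
have cvg : cvgn (density R q).
  apply: nondecreasing_is_cvgn; first exact: density_nondecreasing.
  by exists 2 => _ [n _ <-]; apply: density_le2.
have below n : density R q n <= limn (density R q).
  by apply: nondecreasing_cvgn_le => //; apply: density_nondecreasing.
have above : limn (density R q) <= 2.
  by apply: limr_le => //; near=> n; apply: density_le2.
exists (limn (density R q)); split.
- by rewrite above (le_trans (density0 R q1) (below 0%N)).
- exists (fun n => density R q n - limn (density R q)); split.
    by rewrite -[X in _ --> X](subrr (limn (density R q))); apply: cvgB => //; apply: cvg_cst.
  by move=> n; rewrite addrC subrK; apply: T_density.
- by move=> q3; rewrite above andbT; apply: le_trans (below 10%N); rewrite q3; apply: density10.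
Unshelve. all: by end_near.
Qed.
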